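(* Let $(\nu_n)_{n\ge1}$ be a sequence of strictly aperiodic probability measures on $\mathbb{Z}$ such that (1) $E(\nu_n)=\sum_{k\in\mathbb{Z}}k\,\nu_n(k)=0$ for all $n$; (2) $\phi(n)=\sum_{i=1}^{n} m_2(\nu_i)=O(n)$, where $m_2(\nu)=\sum_{k\in\mathbb{Z}}k^2\nu(k)$; (3) there exist a constant $C>0$ and an integer $N_0>0$ such that $|\hat{\nu}_n(t)|\le e^{-Ct^2}$ for all $n>N_0$ and all $t\in[-1/2,1/2)$. Let $\mu_n=\nu_1*\nu_2*\cdots*\nu_n$. Then $$\sup_{n}\int_{-1/2}^{1/2}|\hat{\mu}_n''(t)|\,|t|\,dt<\infty,$$ and consequently the maximal operator $Mf(x)=\sup_{n}|\mu_nf(x)|$ is of weak type $(1,1)$: there is a constant $C'$ such that for every $\lambda>0$ and every $f\in L^1(X)$, $m\{x\in X: Mf(x)>\lambda\}\le \frac{C'}{\lambda}\|f\|_1$.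
   Context: $(X,\mathcal{B},m)$ is a non-atomic separable probability space and $\tau:X\to X$ is an invertible measure-preserving transformation. For a probability measure $\mu$ on $\mathbb{Z}$ and $f\in L^1(X)$, $\mu f(x)=\sum_{k\in\mathbb{Z}}\mu(k)f(\tau^kx)$. The Fourier transform of a probability measure $\mu$ on $\mathbb{Z}$ is $\hat{\mu}(t)=\sum_{k\in\mathbb{Z}}\mu(k)e^{2\pi ikt}$, $t\in[-1/2,1/2)$. Convolution: $(\mu*\nu)(k)=\sum_{j\in\mathbb{Z}}\mu(k-j)\nu(j)$. A probability measure on $\mathbb{Z}$ is strictly aperiodic if its support is not contained in any proper coset of a subgroup of $\mathbb{Z}$ (equivalently $|\hat\mu(t)|<1$ for all $t\in[-1/2,1/2)\setminus\{0\}$). *)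

(* Defs.v *)
From HB Require Import structures.
From mathcomp Require Import all_boot all_order all_algebra.
From mathcomp Require Import all_classical all_reals all_analysis.
Set Implicit Arguments. Unset Strict Implicit. Unset Printing Implicit Defensive.
Import Order.TTheory GRing.Theory Num.Theory.
Import numFieldNormedType.Exports.
Local Open Scope classical_set_scope.
Local Open Scope ring_scope.

Section Defs.
Variable R : realType.

Definition sym_psum (u : int -> R) (N : nat) : R :=
  \sum_(i < (2 * N).+1) u (i%:Z - N%:Z).

(* sum over Z, as the limit of symmetric partial sums (0 if divergent;
   only used on absolutely summable families, where it is the true sum) *)
Definition zsum (u : int -> R) : R :=
  if pselect (cvgn (sym_psum u)) then limn (sym_psum u) else 0.

Definition is_prob (nu : int -> R) : Prop :=
  (forall k, 0 <= nu k) /\ (\esum_(k in [set: int]) (nu k)%:E = 1)%E.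

Definition strictly_aperiodic (nu : int -> R) : Prop :=
  ~ exists (d : nat) (a : int), d <> 1%N /\
      forall k, nu k != 0 -> (d%:Z %| (k - a))%Z.

Definition m2 (nu : int -> R) : \bar R :=
  (\esum_(k in [set: int]) ((k%:~R) ^+ 2 * nu k)%:E)%E.

Definition hat_re (nu : int -> R) (t : R) : R :=
  zsum (fun k => nu k * cos (2 * pi * k%:~R * t)).
Definition hat_im (nu : int -> R) (t : R) : R :=
  zsum (fun k => nu k * sin (2 * pi * k%:~R * t)).
Definition hat_abs (nu : int -> R) (t : R) : R :=
  Num.sqrt (hat_re nu t ^+ 2 + hat_im nu t ^+ 2).
Definition hat_dd_abs (nu : int -> R) (t : R) : R :=
  Num.sqrt ((derive1n 2 (hat_re nu) t) ^+ 2 + (derive1n 2 (hat_im nu) t) ^+ 2).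

Definition conv (mu nu : int -> R) (k : int) : R :=
  zsum (fun j => mu (k - j) * nu j).

Definition dirac0 (k : int) : R := if k == 0 then 1 else 0.

Fixpoint convn (nu : nat -> int -> R) (n : nat) : int -> R :=
  match n with
  | 0%N => dirac0
  | n'.+1 => conv (convn nu n') (nu n'.+1)
  end.

Definition tauz (X : Type) (tau tau' : X -> X) (k : int) (x : X) : X :=
  match k with
  | Posz n => iter n tau x
  | Negz n => iter n.+1 tau' x
  end.

Definition mu_op (X : Type) (tau tau' : X -> X) (mu : int -> R) (f : X -> R)
  (x : X) : R := zsum (fun k => mu k * f (tauz tau tau' k x)).

Definition max_op (X : Type) (tau tau' : X -> X) (nu : nat -> int -> R)
  (f : X -> R) (x : X) : \bar R :=
  ereal_sup [set (`|mu_op tau tau' (convn nu n) f x|)%:E | n in [set n : nat | (1 <= n)%N]].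

Definition nonatomic d (X : measurableType d) (m : probability X R) : Prop :=
  forall A, measurable A -> (0 < m A)%E ->
    exists B, [/\ measurable B, B `<=` A, (0 < m B)%E & (m B < m A)%E].

Definition separable_space d (X : measurableType d) (m : probability X R) : Prop :=
  exists G : nat -> set X, (forall i, measurable (G i)) /\
    forall A, measurable A -> forall e : R, 0 < e ->
      exists i, (m ((A `\` G i) `|` (G i `\` A)) < e%:E)%E.

Definition inv_mp d (X : measurableType d) (m : probability X R)
  (tau tau' : X -> X) : Prop :=
  [/\ measurable_fun setT tau, measurable_fun setT tau',
      cancel tau tau', cancel tau' tau &
      forall A, measurable A -> m (tau @^-1` A) = m A].

End Defs.

(* Main.v *)
Require Import Defs.
From HB Require Import structures.
From mathcomp Require Import all_boot all_order all_algebra.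
From mathcomp Require Import all_classical all_reals all_analysis.
From mathcomp Require Import measurable_realfun.
From mathcomp Require Import ring lra zify.
Import Order.TTheory GRing.Theory Num.Theory.
Import numFieldNormedType.Exports.
Local Open Scope classical_set_scope.
Local Open Scope ring_scope.

(* By the product rule, the hypotheses bound the transforms of [mu_n] by
   |mu_n^(t)| <= W e^{-C n t^2} and |mu_n^''(t)| <= B n e^{-C n t^2 / 2} on [-1/2, 1/2],
   which gives the integral estimate.  Fourier inversion applied to [mu_n(k)] and to
   [k^2 mu_n(k)] then shows mu_n(k) <= A s / ((s + |k|) (s + |k| + 1)) with s = sqrt n:
   a kernel decreasing in |k| whose sums are bounded uniformly in n.  Summation by parts
   therefore dominates [M f] by the one-sided Hopf maximal functions of |f| along [tau]
   and its inverse, and the maximal ergodic theorem gives the weak type (1,1) bound. *)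

(** * Sums over the integers as integrals *)

(** The weak type bound is not deduced from the integral estimate: both follow from the same
    Gaussian bounds on the transforms. The obstacle is that second moments are controlled only on
    average, so a single [nu i] may have a second moment of order [i]. The product rule estimates
    must therefore be phrased with the accumulated sum [Phi], never with a bound per factor. Since
    each [nu i] is centered, its transform has derivative at most [D i * |t|]; mixed products of
    first derivatives then add up to at most [t^2 Phi^2], and the second derivatives to [Phi]. As
    [Phi = O(n)], the total is of order [n (1 + n t^2)], and half of the Gaussian exponent absorbs
    [n t^2]. A Gaussian of width [1/s], with [s = sqrt n], has integral of order [1/s]: this makes
    the integral of [n |t|] against it bounded, and inversion yields [mu_n(k) = O(1/s)] and
    [k^2 mu_n(k) = O(s)]. Sums over the integers become integrals for a counting measure, so that
    dominated convergence, Fubini and differentiation under the integral apply. Complex numbers are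
    carried as pairs of reals. *)

HB.instance Definition _ := isPointed.Build int 0.
HB.instance Definition _ := @isMeasurable.Build default_measure_display int
  (@discrete_measurable int) (@discrete_measurable0 int) (@discrete_measurableC int)
  (@discrete_measurableU int).

Definition zball (n : nat) : set int := [set k | (`|k| <= n)%N].

(* A copy of [counting]: the library attaches a sigma-finite structure to the
   head constant [counting] over [nat], so it cannot be reused over [int]. *)
Definition zcounting {R : realType} : set int -> \bar R := @counting int R.

HB.instance Definition _ (R : realType) :=
  @isMeasure.Build _ int R zcounting (measure0 (@counting int R))
    (measure_ge0 (@counting int R)) (@measure_semi_sigma_additive _ _ _ (@counting int R)).

Section ZCounting.
Variable R : realType.
Local Notation cnt := (@zcounting R).

Lemma zballE n : zball n = \big[setU/set0]_(i < (2 * n).+1) [set (i%:Z - n%:Z)].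
Proof.
rewrite -(bigcup_mkord _ (fun i => [set (i%:Z - n%:Z)])).
apply/seteqP; split=> k /=.
  move=> kn; by exists (absz (k + n%:Z)) => /=; move: kn; rewrite /zball /=; lia.
by move=> [i /= ik ->]; rewrite /zball /=; lia.
Qed.

Lemma finite_zball n : finite_set (zball n).
Proof.
rewrite zballE -(bigcup_mkord _ (fun i => [set (i%:Z - n%:Z)])).
by apply: bigcup_finite; [exact: finite_II|move=> *; exact: finite_set1].
Qed.

Lemma bigcup_zball : \bigcup_n zball n = setT.
Proof. by apply/seteqP; split=> // k _; exists (absz k) => //; rewrite /zball /=. Qed.

Lemma sigma_finite_zcounting : sigma_finite [set: int] cnt.
Proof.
exists zball; first by rewrite bigcup_zball.
move=> n; split => //; rewrite /zcounting /counting/= asboolT ?ltry//; exact: finite_zball.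
Qed.

Lemma zmeasurable_fun d (T : measurableType d) (A : set int) (f : int -> T) :
  measurable_fun A f.
Proof. by []. Qed.

Lemma integral_zball (u : int -> R) n :
  (\int[cnt]_(k in zball n) (u k)%:E = (sym_psum u n)%:E)%E.
Proof.
have -> : zball n = \big[setU/set0]_(0 <= i < (2 * n).+1) [set (i%:Z - n%:Z)].
  by rewrite zballE -(big_mkord xpredT (fun i => [set (i%:Z - n%:Z)])).
rewrite integral_bigsetU_EFin //=.
- rewrite /sym_psum -sumEFin (big_mkord xpredT).
  apply: eq_bigr => i _.
  rewrite (eq_integral (cst (u (i%:Z - n%:Z))%:E)); last first.
    by move=> k; rewrite inE /= => ->.
  rewrite integral_cst//= /zcounting /counting asboolT; last exact: finite_set1.
  by rewrite fset_set1 finmap.cardfs1 mule1.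
- exact: (iota_uniq 0 (2 * n).+1).
- by move=> i j _ _ [k [/= -> ]]; lia.
Qed.

Lemma counting_bij (f : int -> int) (A : set int) : bijective f ->
  cnt (f @^-1` A) = cnt A.
Proof.
move=> [g fg gf].
have AE : A = f @` (f @^-1` A).
  apply/seteqP; split=> [k Ak|k [l Al <-]//].
  by exists (g k); rewrite /= ?gf.
have [fA|nfA] := pselect (finite_set (f @^-1` A)).
  have fA' : finite_set A by rewrite AE; exact: finite_image.
  rewrite /zcounting /counting !asboolT//.
  rewrite [in RHS]AE fset_set_image// finmap.card_imfset//=.
  exact: can_inj fg.
have nfA' : ~ finite_set A.
  move=> fA; apply: nfA; apply: finite_preimage => // x y _ _; exact: (can_inj fg).
by rewrite /zcounting /counting !asboolF.
Qed.

(** Counting measure is its own image under a translation, so this is a change of variables. *)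
Lemma ge0_integral_zshift (u : int -> \bar R) (j : int) :
  (forall k, 0 <= u k)%E ->
  (\int[cnt]_k u (k - j)%R = \int[cnt]_k u k)%E.
Proof.
move=> u0.
have mf : measurable_fun setT (fun k : int => k - j) by [].
rewrite -(@ge0_integral_pushforward _ _ _ _ _ _ mf cnt setT u) //.
apply: eq_measure_integral => A _ _.
apply: (@counting_bij (fun k => k - j) A).
by apply: (Bijective (g := fun k => k + j)) => k; lia.
Qed.

Lemma integral_zshift (u : int -> R) (j : int) :
  cnt.-integrable setT (EFin \o u) ->
  \int[cnt]_k u (k - j) = \int[cnt]_k u k.
Proof.
move=> iu.
rewrite /Rintegral [in RHS]integralE [in LHS]integralE.
congr (fine (_ - _)).
  rewrite -(ge0_integral_zshift (fun k => (u k)%:E)^\+%E j); last exact: funepos_ge0.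
  by apply: eq_integral => k _; rewrite !funeposE.
rewrite -(ge0_integral_zshift (fun k => (u k)%:E)^\-%E j); last exact: funeneg_ge0.
by apply: eq_integral => k _; rewrite !funenegE.
Qed.

(** Dominated convergence along the windows [zball n]: every integer is eventually inside, and [|u|]
    dominates. *)
Lemma sym_psum_cvg (u : int -> R) : cnt.-integrable setT (EFin \o u) ->
  sym_psum u @ \oo --> \int[cnt]_k u k.
Proof.
move=> iu.
have -> : sym_psum u = fun n => fine (\int[cnt]_k ((EFin \o u) \_ (zball n)) k)%E.
  by apply/funext => n; rewrite -integral_mkcond integral_zball.
apply: fine_cvg; rewrite fineK; last exact: integrable_fin_num.
apply: (@dominated_cvg _ int R cnt setT measurableT _ _ (fun k => `|(u k)%:E|%E)) => //.
- move=> k _; apply: cvg_near_cst.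
  exists (absz k) => // n /= kn.
  by rewrite patchE mem_set.
- exact: integrable_abse.
- by move=> n k _; rewrite patchE; case: ifP => // _; rewrite abse0 lee_fin.
Qed.

(** Absolutely summable families never reach the default value of [zsum]. *)
Lemma zsumE (u : int -> R) : cnt.-integrable setT (EFin \o u) ->
  zsum u = \int[cnt]_k u k.
Proof.
move=> iu; have uc := sym_psum_cvg _ iu.
rewrite /zsum; case: pselect => [c|nc] /=.
  exact/cvg_lim.
by exfalso; apply: nc; apply/cvg_ex; eexists; exact: uc.
Qed.

(** Total mass and second moments are given as [esum]s, and only upper bounds are drawn from them;
    one inequality suffices. *)
Lemma ge0_integral_le_esum (u : int -> R) : (forall k, 0 <= u k) ->
  (\int[cnt]_k (u k)%:E <= \esum_(k in [set: int]) (u k)%:E)%E.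
Proof.
move=> u0.
have h : (\int[cnt]_(k in zball n) (u k)%:E)%E @[n --> \oo] -->
    (\int[cnt]_(k in \bigcup_n zball n) (u k)%:E)%E.
  apply: ge0_nondecreasing_set_cvg_integral => //.
  - move=> n m nm; apply/subsetPset => k; rewrite /zball /=.
    by move=> /leq_trans; exact.
  - by move=> n k _; rewrite lee_fin.
move: h; rewrite bigcup_zball => h.
rewrite -(cvg_lim _ h) //; apply: lime_le; first by apply/cvg_ex; eexists; exact: h.
apply: nearW => n; rewrite integral_zball; apply: esum_ge.
exists (zball n); first by split => //; exact: finite_zball.
rewrite /sym_psum -sumEFin zballE -(bigcup_mkord _ (fun i => [set (i%:Z - n%:Z)])).
rewrite (reindex_fsbig (fun i : nat => i%:Z - n%:Z) `I_((2 * n).+1)); last first.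
  split=> [i /= ik|i j _ _ /=|k [i /= ik ->]]; [by exists i|by lia|by exists i].
by rewrite -fsbig_ord.
Qed.

Lemma norm_le_integral (u : int -> R) k : cnt.-integrable setT (EFin \o u) ->
  `|u k| <= \int[cnt]_j `|u j|.
Proof.
move=> iu.
rewrite -lee_fin /Rintegral fineK; last first.
  apply: integrable_fin_num => //.
  exact: (integrable_abse iu).
apply: (@le_trans _ _ (\int[cnt]_(j in [set k]) `|u j|%:E)%E).
  rewrite (eq_integral (cst `|u k|%:E)); last by move=> j; rewrite inE /= => ->.
  rewrite integral_cst//= /zcounting /counting asboolT; last exact: finite_set1.
  by rewrite fset_set1 finmap.cardfs1 mule1.
by apply: ge0_subset_integral.
Qed.

End ZCounting.

HB.instance Definition _ (R : realType) :=
  @Measure_isSigmaFinite.Build _ int R (@zcounting R) (sigma_finite_zcounting R).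

(** * Fourier transforms and convolutions *)

Section Transform.
Variable R : realType.
Local Notation cnt := (@zcounting R).
Implicit Types u v w : int -> R.

Definition l1 u := cnt.-integrable setT (EFin \o u).

(* Up to a factor [i], the derivative of the transform of [u] is the transform of [kap u]. *)
Definition kap u (k : int) : R := 2 * pi * k%:~R * u k.

Lemma l1_le u v : (forall k, `|u k| <= `|v k|) -> l1 v -> l1 u.
Proof. by move=> uv; apply: le_integrable => // k _; rewrite lee_fin. Qed.

Lemma l1_norm u : l1 u -> l1 (fun k => `|u k|).
Proof. by apply: l1_le => k; rewrite normr_id. Qed.

Lemma l1D u v : l1 u -> l1 v -> l1 (fun k => u k + v k).
Proof. by move=> iu iv; apply: eq_integrable (integrableD _ iu iv). Qed.

Lemma l1Z a u : l1 u -> l1 (fun k => a * u k).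
Proof. by move=> iu; apply: eq_integrable (integrableZl _ a iu). Qed.

Lemma l1M u w (M : R) : (forall k, `|w k| <= M) -> l1 u -> l1 (fun k => u k * w k).
Proof.
move=> wM iu; apply: l1_le (l1Z M _ iu) => k.
rewrite !normrM mulrC ler_wpM2r// (le_trans (wM k))//.
exact: ler_norm.
Qed.

Lemma l1_shift u j : l1 u -> l1 (fun k => u (k - j)).
Proof.
move=> /integrableP[_ ui]; apply/integrableP; split=> //.
by rewrite (ge0_integral_zshift _ (fun k => `|(u k)%:E|%E)).
Qed.

Lemma l1_bound u : l1 u -> exists M : R, forall k, `|u k| <= M.
Proof. by move=> iu; exists (\int[cnt]_j `|u j|) => k; exact: norm_le_integral. Qed.

Lemma zprod_measurable (A : set (int * int)) : measurable A.
Proof.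
apply: countable_measurable => [[a b]|]; last exact: countableP.
have -> : [set (a, b)] = [set a] `*` [set b].
  by apply/seteqP; split=> [_ ->//|[x y] [/= -> ->]].
exact: measurableX.
Qed.

Lemma convE u v k : l1 u -> l1 v -> Defs.conv u v k = \int[cnt]_j (u (k - j) * v j).
Proof.
move=> iu iv; apply: zsumE.
have [M uM] := l1_bound _ iu.
have := l1M v (fun j => u (k - j)) M (fun j => uM (k - j)) iv.
by apply: l1_le => j; rewrite mulrC.
Qed.

(** One bounded test sequence serves three times: [w = 1] for the summability of a convolution,
    cosine and sine for the two parts of its transform. *)
Lemma conv_Fubini u v w (M : R) : l1 u -> l1 v -> (forall k, `|w k| <= M) ->
  l1 (fun k => Defs.conv u v k * w k) /\
  \int[cnt]_k (Defs.conv u v k * w k) = \int[cnt]_j (v j * \int[cnt]_k (u k * w (k + j))).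
Proof.
move=> iu iv wM.
have [Mu uM] := l1_bound _ iu.
have M0 : 0 <= M by exact: le_trans (wM 0).
pose f (p : int * int) : \bar R := (u (p.1 - p.2) * v p.2 * w p.1)%:E.
have mf : measurable_fun setT f by move=> _ A mA; exact: zprod_measurable.
have fint : (cnt \x cnt)%E.-integrable setT f.
  apply/(integrable21ltyP _ _ mf).
  have iuf := integrable_fin_num measurableT (l1_norm _ iu).
  apply: (@le_lt_trans _ _ (\int[cnt]_j ((M * \int[cnt]_k `|u k|) * `|v j|)%:E)%E).
    apply: ge0_le_integral => //.
    - by move=> j _; exact: integral_ge0.
    move=> j _.
    apply: (@le_trans _ _ (\int[cnt]_k ((M * `|v j|)%:E * `|u (k - j)|%:E))%E).
      apply: ge0_le_integral => //.
      move=> k _; rewrite /f/= -EFinM lee_fin !normrM -subr_ge0.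
      rewrite (_ : _ - _ = (M - `|w k|) * (`|u (k - j)| * `|v j|)); last by ring.
      by apply: mulr_ge0; [rewrite subr_ge0|exact: mulr_ge0].
    rewrite ge0_integralZl//; last by rewrite lee_fin mulr_ge0.
    rewrite (ge0_integral_zshift _ (fun k => `|u k|%:E))//.
    rewrite -(fineK iuf) -EFinM lee_fin -/(Rintegral _ _ _).
    by rewrite mulrAC.
  have := l1Z (M * \int[cnt]_k `|u k|) _ (l1_norm _ iv).
  move=> /integrableP[_]; apply: le_lt_trans.
  apply: ge0_le_integral => //.
  - move=> j _; rewrite lee_fin; apply: mulr_ge0 => //; apply: mulr_ge0 => //.
    exact: Rintegral_ge0.
  - by move=> j _; rewrite lee_fin ler_norm.
have FE k : fubini_F cnt f k = (Defs.conv u v k * w k)%:E.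
  rewrite /fubini_F /f/= convE//.
  have iuv : l1 (fun j => u (k - j) * v j).
    have := l1M v (fun j => u (k - j)) Mu (fun j => uM (k - j)) iv.
    by apply: l1_le => j; rewrite mulrC.
  rewrite -RintegralZr// /Rintegral fineK//.
  by apply: integrable_fin_num => //; exact: (l1M _ (fun=> w k) _ (fun=> wM k)).
split.
  by apply: eq_integrable (integrable_fubini_F fint) => // k _; rewrite FE.
rewrite {1}/Rintegral -(eq_integral _ _ (fun k _ => FE k)) /fubini_F (Fubini fint).
congr fine; apply: eq_integral => j _; rewrite /f/=.
have iuw : l1 (fun k => u k * w (k + j)) by apply: l1M iu => k; exact: wM.
rewrite -RintegralZl//.
rewrite -(integral_zshift _ (fun k => v j * (u k * w (k + j))) j); last exact: l1Z.
rewrite /Rintegral fineK.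
  by apply: eq_integral => k _; rewrite subrK mulrCA mulrA.
apply: integrable_fin_num => //.
exact: (l1_shift (fun k => v j * (u k * w (k + j)))  j (l1Z _ _ iuw)).
Qed.

Lemma l1_conv u v : l1 u -> l1 v -> l1 (Defs.conv u v).
Proof.
move=> iu iv; have w1 (k : int) : `|1 : R| <= 1 by rewrite normr1.
have [+ _] := conv_Fubini u v (fun=> 1) 1 iu iv w1.
by apply: eq_integrable => // k _; rewrite /= mulr1.
Qed.

(** The product rule, seen before transforming: it is [k = (k - j) + j] under the sum. *)
Lemma kap_conv u v : l1 u -> l1 v -> l1 (kap u) -> l1 (kap v) ->
  kap (Defs.conv u v) = fun k => Defs.conv (kap u) v k + Defs.conv u (kap v) k.
Proof.
move=> iu iv iku ikv; apply/funext => k.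
have h a b : l1 a -> l1 b -> l1 (fun j => a (k - j) * b j).
  move=> ia ib; have [M aM] := l1_bound _ ia.
  have := l1M b (fun j => a (k - j)) M (fun j => aM (k - j)) ib.
  by apply: l1_le => j; rewrite mulrC.
rewrite !convE// {1}/kap convE// -RintegralD//; [|exact: h..].
rewrite -RintegralZl//; last exact: h.
apply: eq_Rintegral => j _; rewrite /kap.
have -> : (k%:~R : R) = (k - j)%:~R + j%:~R by rewrite -intrD subrK.
by ring.
Qed.

Local Notation ang k t := (2 * pi * k%:~R * t).

Lemma hat_reE u (t : R) : l1 u -> hat_re u t = \int[cnt]_k (u k * cos (ang k t)).
Proof. by move=> iu; apply: zsumE; apply: l1M iu => k; exact: cos_max. Qed.

Lemma hat_imE u (t : R) : l1 u -> hat_im u t = \int[cnt]_k (u k * sin (ang k t)).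
Proof. by move=> iu; apply: zsumE; apply: l1M iu => k; exact: sin_max. Qed.

Lemma hat_reD u v (t : R) : l1 u -> l1 v ->
  hat_re (fun k => u k + v k) t = hat_re u t + hat_re v t.
Proof.
move=> iu iv; rewrite !hat_reE//; last exact: l1D.
rewrite -RintegralD//; [|by apply: l1M => // k; exact: cos_max..].
by apply: eq_Rintegral => k _; rewrite mulrDl.
Qed.

Lemma hat_imD u v (t : R) : l1 u -> l1 v ->
  hat_im (fun k => u k + v k) t = hat_im u t + hat_im v t.
Proof.
move=> iu iv; rewrite !hat_imE//; last exact: l1D.
rewrite -RintegralD//; [|by apply: l1M => // k; exact: sin_max..].
by apply: eq_Rintegral => k _; rewrite mulrDl.
Qed.

Lemma hat_re_conv u v (t : R) : l1 u -> l1 v ->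
  hat_re (Defs.conv u v) t = hat_re u t * hat_re v t - hat_im u t * hat_im v t.
Proof.
move=> iu iv.
have iuc : l1 (fun k => u k * cos (ang k t)) by apply: l1M iu => k; exact: cos_max.
have ius : l1 (fun k => u k * sin (ang k t)) by apply: l1M iu => k; exact: sin_max.
have ivc : l1 (fun k => v k * cos (ang k t)) by apply: l1M iv => k; exact: cos_max.
have ivs : l1 (fun k => v k * sin (ang k t)) by apply: l1M iv => k; exact: sin_max.
have [_] := conv_Fubini u v (fun k => cos (ang k t)) 1 iu iv (fun=> cos_max _).
rewrite hat_reE; last exact: l1_conv.
move=> ->.
rewrite (hat_reE v)// (hat_imE v)// -!RintegralZl//.
rewrite -RintegralB//; [|exact: l1Z..].
apply: eq_Rintegral => j _.
rewrite hat_reE// hat_imE// mulrCA [X in _ - X]mulrCA -mulrBr; congr (_ * _).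
rewrite -!RintegralZr// -RintegralB//.
- apply: eq_Rintegral => k _; rewrite intrD mulrDr mulrDl cosD mulrBr.
  by rewrite !mulrA.
- by apply: (l1M _ _ 1) iuc => k; exact: cos_max.
- by apply: (l1M _ _ 1) ius => k; exact: sin_max.
Qed.

Lemma hat_im_conv u v (t : R) : l1 u -> l1 v ->
  hat_im (Defs.conv u v) t = hat_re u t * hat_im v t + hat_im u t * hat_re v t.
Proof.
move=> iu iv.
have iuc : l1 (fun k => u k * cos (ang k t)) by apply: l1M iu => k; exact: cos_max.
have ius : l1 (fun k => u k * sin (ang k t)) by apply: l1M iu => k; exact: sin_max.
have ivc : l1 (fun k => v k * cos (ang k t)) by apply: l1M iv => k; exact: cos_max.
have ivs : l1 (fun k => v k * sin (ang k t)) by apply: l1M iv => k; exact: sin_max.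
have [_] := conv_Fubini u v (fun k => sin (ang k t)) 1 iu iv (fun=> sin_max _).
rewrite hat_imE; last exact: l1_conv.
move=> ->.
rewrite (hat_reE v)// (hat_imE v)// -!RintegralZl//.
rewrite -RintegralD//; [|exact: l1Z..].
apply: eq_Rintegral => j _.
rewrite hat_reE// hat_imE// mulrCA [X in _ + X]mulrCA -mulrDr; congr (_ * _).
rewrite -!RintegralZr// -RintegralD//.
- apply: eq_Rintegral => k _; rewrite intrD mulrDr mulrDl sinD mulrDr.
  by rewrite !mulrA addrC.
- by apply: (l1M _ _ 1) iuc => k; exact: sin_max.
- by apply: (l1M _ _ 1) ius => k; exact: cos_max.
Qed.

Lemma is_derive_hat_re u (t : R) : l1 u -> l1 (kap u) ->
  is_derive t (1 : R) (hat_re u) (- hat_im (kap u) t).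
Proof.
move=> iu ik.
have -> : hat_re u = fun x => \int[cnt]_k (u k * cos (ang k x)).
  by apply/funext => x; exact: hat_reE.
have dl k (x : R) : is_derive x (1 : R) (fun x : R => ang k x) (2 * pi * k%:~R).
  apply: is_derive_eq (is_deriveZ (2 * pi * k%:~R) (is_derive_id x (1 : R))) _.
  by rewrite /GRing.scale /= mulr1.
have d k (x : R) : is_derive x (1 : R) (fun x : R => u k * cos (ang k x)) (- (kap u k * sin (ang k x))).
  apply: is_derive_eq (is_deriveZ (u k) (is_derive1_comp (is_derive_cos (ang k x)) (dl k x))) _.
  by rewrite /kap /GRing.scale /=; ring.
(* Any open interval around [t] will do: the bound [|kap u|] on the differentiated terms is uniform
   in the variable. *)
pose I := `]t - 1, t + 1[.
have It : [set` I] t by rewrite /I /= in_itv /=; apply/andP; split; lra.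
have h1 (x : R) : [set` I] x -> cnt.-integrable setT (EFin \o (fun k => u k * cos (ang k x))).
  by move=> _; apply: l1M iu => k; exact: cos_max.
have h2 (x : R) k : [set` I] x -> setT k -> derivable ((fun (x : R) k => u k * cos (ang k x)) ^~ k) x 1.
  by move=> _ _; exact: (@ex_derive _ _ _ _ _ _ _ (d k x)).
have pE (x : R) k : partial1of2 (fun (x : R) k => u k * cos (ang k x)) x k = - (kap u k * sin (ang k x)).
  by rewrite partial1of2E; exact: (@derive_val _ _ _ _ _ _ _ (d k x)).
have h3 (x : R) k : [set` I] x -> setT k ->
   `|partial1of2 (fun (x : R) k => u k * cos (ang k x)) x k| <= `|kap u k|.
  by move=> _ _; rewrite pE normrN normrM ler_piMr// sin_max.
have h4 := l1_norm _ ik.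
apply: DeriveDef.
  exact: (derivable_under_integral measurableT It h1 h2 _ h4 h3).
rewrite -derive1E (differentiation_under_integral measurableT It h1 h2 _ h4 h3)//.
rewrite hat_imE// -[RHS]mulN1r -RintegralZl//; last by apply: l1M ik => k; exact: sin_max.
by apply: eq_Rintegral => k _; rewrite pE mulN1r.
Qed.

Lemma is_derive_hat_im u (t : R) : l1 u -> l1 (kap u) ->
  is_derive t (1 : R) (hat_im u) (hat_re (kap u) t).
Proof.
move=> iu ik.
have -> : hat_im u = fun x => \int[cnt]_k (u k * sin (ang k x)).
  by apply/funext => x; exact: hat_imE.
have dl k (x : R) : is_derive x (1 : R) (fun x : R => ang k x) (2 * pi * k%:~R).
  apply: is_derive_eq (is_deriveZ (2 * pi * k%:~R) (is_derive_id x (1 : R))) _.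
  by rewrite /GRing.scale /= mulr1.
have d k (x : R) : is_derive x (1 : R) (fun x : R => u k * sin (ang k x)) (kap u k * cos (ang k x)).
  apply: is_derive_eq (is_deriveZ (u k) (is_derive1_comp (is_derive_sin (ang k x)) (dl k x))) _.
  by rewrite /kap /GRing.scale /=; ring.
pose I := `]t - 1, t + 1[.
have It : [set` I] t by rewrite /I /= in_itv /=; apply/andP; split; lra.
have h1 (x : R) : [set` I] x -> cnt.-integrable setT (EFin \o (fun k => u k * sin (ang k x))).
  by move=> _; apply: l1M iu => k; exact: sin_max.
have h2 (x : R) k : [set` I] x -> setT k -> derivable ((fun (x : R) k => u k * sin (ang k x)) ^~ k) x 1.
  by move=> _ _; exact: (@ex_derive _ _ _ _ _ _ _ (d k x)).
have pE (x : R) k : partial1of2 (fun (x : R) k => u k * sin (ang k x)) x k = kap u k * cos (ang k x).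
  by rewrite partial1of2E; exact: (@derive_val _ _ _ _ _ _ _ (d k x)).
have h3 (x : R) k : [set` I] x -> setT k ->
   `|partial1of2 (fun (x : R) k => u k * sin (ang k x)) x k| <= `|kap u k|.
  by move=> _ _; rewrite pE normrM ler_piMr// cos_max.
have h4 := l1_norm _ ik.
apply: DeriveDef.
  exact: (derivable_under_integral measurableT It h1 h2 _ h4 h3).
rewrite -derive1E (differentiation_under_integral measurableT It h1 h2 _ h4 h3)//.
rewrite hat_reE//.
by apply: eq_Rintegral => k _; rewrite pE.
Qed.

End Transform.

(** * Bounds on transforms *)

Section Modulus.
Variable R : realType.
Implicit Types a b c d x : R.

Definition cabs a b : R := Num.sqrt (a ^+ 2 + b ^+ 2).

Lemma cabs_ge0 a b : 0 <= cabs a b. Proof. exact: sqrtr_ge0. Qed.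

Lemma sqr_cabs a b : cabs a b ^+ 2 = a ^+ 2 + b ^+ 2.
Proof. by rewrite sqr_sqrtr// addr_ge0 ?sqr_ge0. Qed.

Lemma cabsM a b c d : cabs (a * c - b * d) (a * d + b * c) = cabs a b * cabs c d.
Proof.
rewrite /cabs -sqrtrM ?addr_ge0 ?sqr_ge0//; congr Num.sqrt; ring.
Qed.

Lemma cabsNr a b : cabs a (- b) = cabs a b.
Proof. by rewrite /cabs sqrrN. Qed.

Lemma normr_le_cabs a b : `|a| <= cabs a b.
Proof. by rewrite -sqrtr_sqr ler_sqrt ?addr_ge0 ?sqr_ge0// lerDl sqr_ge0. Qed.

(** Cauchy-Schwarz in the plane: the left side is the real part of a product of one number with the
    conjugate of the other, and [cabs] is multiplicative. *)
Lemma dot_le_cabs a b c d : a * c + b * d <= cabs a b * cabs c d.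
Proof.
rewrite -(cabsNr c d) -cabsM; apply: le_trans (normr_le_cabs _ _).
by rewrite mulrN opprK ler_norm.
Qed.

Lemma cabs_cos_sin x : cabs (cos x) (sin x) = 1.
Proof. by rewrite /cabs cos2Dsin2 sqrtr1. Qed.

Lemma cabsD a b c d : cabs (a + c) (b + d) <= cabs a b + cabs c d.
Proof.
rewrite -(@ler_pXn2r _ 2) ?nnegrE ?addr_ge0 ?cabs_ge0//.
rewrite sqrrD !sqr_cabs.
have := dot_le_cabs a b c d; lra.
Qed.

Lemma cabs_le a b : cabs a b <= `|a| + `|b|.
Proof.
rewrite -(@ler_pXn2r _ 2) ?nnegrE ?addr_ge0 ?cabs_ge0//.
rewrite sqr_cabs sqrrD !real_normK ?num_real//.
have := mulr_ge0 (normr_ge0 a) (normr_ge0 b); lra.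
Qed.

Lemma lipschitz1 (f df : R -> R) x : (forall y, is_derive y (1 : R) f (df y)) ->
  (forall y, `|df y| <= 1) -> `|f x - f 0| <= `|x|.
Proof.
move=> fd df1.
have fc y : {for y, continuous f}.
  by apply: differentiable_continuous; apply/derivable1_diffP; exact: ex_derive.
have [x0|x0] := leP 0 x.
  have [|c _ ->] := MVT_segment x0 (fun y _ => fd y); first exact: continuous_subspaceT.
  by rewrite subr0 normrM ler_piMl.
have [|c _ h] := MVT_segment (ltW x0) (fun y _ => fd y); first exact: continuous_subspaceT.
by rewrite distrC h sub0r normrM normrN ler_piMl.
Qed.

Lemma norm_sin_le x : `|sin x| <= `|x|.
Proof.
have := lipschitz1 sin cos x (fun y => is_derive_sin y) (fun y => cos_max y).
by rewrite sin0 subr0.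
Qed.

Lemma norm_cosB1_le x : `|cos x - 1| <= `|x|.
Proof.
have h y : `|- sin y| <= 1 :> R by rewrite normrN sin_max.
by have := lipschitz1 cos (fun y => - sin y) x (fun y => is_derive_cos y) h; rewrite cos0.
Qed.

End Modulus.

Section TransformBounds.
Variable R : realType.
Local Notation cnt := (@zcounting R).
Local Notation ang k t := (2 * pi * k%:~R * t).
Implicit Types (u : int -> R) (t : R).

(** With the transform written [a + ib] and [r] its modulus, [r^2] is the sum of
    [u k * (a cos + b sin)], and each bracket is at most [r]. Dividing by [r] gives the sharp
    constant 1, which splitting into real and imaginary parts would lose. *)
Lemma cabs_hat_le u t : l1 R u -> cabs R (hat_re u t) (hat_im u t) <= \int[cnt]_k `|u k|.
Proof.
move=> iu.
set a := hat_re u t; set b := hat_im u t; set r := cabs R a b.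
have iuc : l1 R (fun k => u k * cos (ang k t)) by apply: l1M iu => k; exact: cos_max.
have ius : l1 R (fun k => u k * sin (ang k t)) by apply: l1M iu => k; exact: sin_max.
have r2 : r ^+ 2 <= r * \int[cnt]_k `|u k|.
  rewrite /r sqr_cabs -/r 2!expr2 {2}/a {2}/b hat_reE// hat_imE//.
  rewrite -!RintegralZl//; [|exact: l1_norm].
  rewrite -RintegralD//; [|exact: l1Z..].
  apply: le_Rintegral => //.
  - by apply: l1D; exact: l1Z.
  - by apply: l1Z; exact: l1_norm.
  move=> k _.
  rewrite (_ : _ + _ = u k * (a * cos (ang k t) + b * sin (ang k t))); last by ring.
  apply: le_trans (ler_norm _) _; rewrite normrM mulrC ler_wpM2r//.
  have := normr_le_cabs R (a * cos (ang k t) - b * (- sin (ang k t)))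
     (a * (- sin (ang k t)) + b * cos (ang k t)).
  by rewrite cabsM cabsNr cabs_cos_sin mulr1 mulrN opprK.
have [r0|r0] := eqVneq r 0; first by rewrite r0; exact: Rintegral_ge0.
by rewrite -(@ler_pM2l _ r) -?expr2// lt_neqAle eq_sym r0 cabs_ge0.
Qed.

(** Zero mean allows [cos] to be replaced by [cos - 1]; then [|cos x - 1|] and [|sin x|] are both at
    most [|x|], one for each half of the factor 2. For [u = kap nu] this is where centering makes
    the first derivative of the transform of [nu] vanish linearly at 0. *)
Lemma cabs_hat_mean0_le u t : l1 R u -> l1 R (kap R u) -> \int[cnt]_k u k = 0 ->
  cabs R (hat_re u t) (hat_im u t) <= 2 * \int[cnt]_k `|kap R u k| * `|t|.
Proof.
move=> iu ik u0.
have iuc : l1 R (fun k => u k * cos (ang k t)) by apply: l1M iu => k; exact: cos_max.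
have ius : l1 R (fun k => u k * sin (ang k t)) by apply: l1M iu => k; exact: sin_max.
have ikt : l1 R (fun k => `|kap R u k| * `|t|).
  by apply: (l1M _ _ _ `|t|) (l1_norm _ _ ik) => k; rewrite normr_id.
apply: (le_trans (cabs_le _ _ _)).
rewrite -mulrA (mulrDl 1 1) !mul1r; apply: lerD.
  have -> : hat_re u t = \int[cnt]_k (u k * (cos (ang k t) - 1)).
    rewrite hat_reE// -[LHS]subr0 -u0 -RintegralB//.
    by apply: eq_Rintegral => k _; rewrite mulrBr mulr1.
  have i1 : l1 R (fun k => u k * (cos (ang k t) - 1)).
    apply: (l1M _ _ _ 2) iu => k; rewrite (le_trans (ler_normB _ _))//.
    by rewrite normr1 lerD// cos_max.
  apply: (le_trans (le_normr_Rintegral _ _)) => //.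
  rewrite -RintegralZr//; last exact: l1_norm.
  apply: le_Rintegral => //; first exact: l1_norm.
  move=> k _; rewrite normrM /kap [X in _ <= X * _]normrM [leRHS]mulrAC [leLHS]mulrC.
  rewrite ler_wpM2r// (le_trans (norm_cosB1_le _ _))//.
  by rewrite normrM.
rewrite hat_imE//.
apply: (le_trans (le_normr_Rintegral _ _)) => //.
rewrite -RintegralZr//; last exact: l1_norm.
apply: le_Rintegral => //; first exact: l1_norm.
move=> k _; rewrite normrM /kap [X in _ <= X * _]normrM [leRHS]mulrAC [leLHS]mulrC.
rewrite ler_wpM2r// (le_trans (norm_sin_le _ _))//.
by rewrite normrM.
Qed.

End TransformBounds.

(** * The product rule as a recursion on moduli *)

Section Recursion.
Variable R : realType.
Variables (P0 P1 P2 p0 p1 p2 D : nat -> R) (q tau : R) (N0 : nat).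
Hypotheses (q0 : 0 <= q) (q1 : q <= 1) (tau0 : 0 <= tau).
Hypotheses (P0_ge0 : forall n, 0 <= P0 n) (P1_ge0 : forall n, 0 <= P1 n)
  (P2_ge0 : forall n, 0 <= P2 n) (p0_ge0 : forall n, 0 <= p0 n)
  (p1_ge0 : forall n, 0 <= p1 n) (p2_ge0 : forall n, 0 <= p2 n).
Hypotheses (P00 : P0 0%N <= 1) (P10 : P1 0%N <= 0) (P20 : P2 0%N <= 0).
Hypotheses (p0le1 : forall n, p0 n.+1 <= 1) (p0leq : forall n, (N0 < n)%N -> p0 n <= q).
Hypotheses (p1le : forall n, p1 n.+1 <= D n.+1 * tau) (p2le : forall n, p2 n.+1 <= D n.+1).
Hypotheses (P0S : forall n, P0 n.+1 <= P0 n * p0 n.+1)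
  (P1S : forall n, P1 n.+1 <= P1 n * p0 n.+1 + P0 n * p1 n.+1)
  (P2S : forall n, P2 n.+1 <= P2 n * p0 n.+1 + 2 * (P1 n * p1 n.+1) + P0 n * p2 n.+1).

Let Phi n := \sum_(1 <= i < n.+1) D i.

(* [P0], [P1], [P2] stand for the moduli of [mu_n^] and its first two derivatives at a
   point, [p0], [p1], [p2] for those of [nu_n^]; the subtractions in the exponents are
   truncated, which accounts for the factors [p0 i] with [i <= N0], only known to be
   at most 1. *)
Lemma product_rule_bounds n :
  [/\ P0 n <= q ^+ (n - N0), P1 n <= Phi n * tau * q ^+ (n - N0.+1) &
   P2 n <= Phi n * q ^+ (n - N0.+1) + (tau * Phi n) ^+ 2 * q ^+ (n - N0.+2)].
Proof.
have D0 k : 0 <= D k.+1 by exact: le_trans (p2le k).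
have Phi0 k : 0 <= Phi k.
  by rewrite /Phi big_add1 /= sumr_ge0.
have PhiS k : Phi k.+1 = Phi k + D k.+1 by rewrite /Phi big_nat_recr.
elim: n => [|n [IH0 IH1 IH2]].
  rewrite !sub0n !expr0 /Phi big_geq//; split=> //; first by rewrite !mul0r.
  by rewrite mul0r mulr0 expr0n /= mul0r addr0.
(* The new factor has index [n.+1], hence decays once [N0 <= n]. Before that all the truncated
   exponents remain 0, and the bound 1 is enough. *)
pose b := if (N0 <= n)%N then q else 1.
have b0 : 0 <= b by rewrite /b; case: ifP.
have pb : p0 n.+1 <= b by rewrite /b; case: ifP => h; [exact: p0leq|exact: p0le1].
have qle k l : (l <= k)%N -> q ^+ k <= q ^+ l by move=> ?; exact: ler_wiXn2l.
have e0 : q ^+ (n - N0) * b <= q ^+ (n.+1 - N0).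
  rewrite /b; case: leqP => h; first by rewrite -exprSr subSn.
  by rewrite mulr1 qle//; (move: h; clear; lia).
have e1 : q ^+ (n - N0.+1) * b <= q ^+ (n.+1 - N0.+1).
  rewrite /b; case: leqP => h; first by rewrite -exprSr qle//; (move: h; clear; lia).
  by rewrite mulr1 qle//; (move: h; clear; lia).
have e2 : q ^+ (n - N0.+2) * b <= q ^+ (n.+1 - N0.+2).
  rewrite /b; case: leqP => h; first by rewrite -exprSr qle//; (move: h; clear; lia).
  by rewrite mulr1 qle//; (move: h; clear; lia).
have E1 : (n.+1 - N0.+1 = n - N0)%N by rewrite subSS.
have E2 : (n.+1 - N0.+2 = n - N0.+1)%N by rewrite subSS.
move: e1 e2; rewrite E1 E2 PhiS => e1 e2.
move: IH0 IH1 IH2 e0 e1 e2.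
have := exprn_ge0 (n - N0) q0; have := exprn_ge0 (n - N0.+1) q0.
have := exprn_ge0 (n - N0.+2) q0.
move: (q ^+ (n - N0)) (q ^+ (n - N0.+1)) (q ^+ (n - N0.+2)) => x y z z0 y0 x0.
move=> IH0 IH1 IH2 e0 e1 e2.
have Dn := D0 n; have Fn := Phi0 n.
split.
- apply: le_trans (P0S n) _; apply: le_trans e0.
  exact: ler_pM.
- apply: le_trans (P1S n) _; rewrite mulrDl mulrDl; apply: lerD.
    apply: (@le_trans _ _ (Phi n * tau * y * b)); first exact: ler_pM.
    by rewrite -mulrA ler_wpM2l// mulr_ge0.
  by rewrite [leRHS]mulrC; exact: ler_pM.
apply: le_trans (P2S n) _.
have h1 : P2 n * p0 n.+1 <= Phi n * x + (tau * Phi n) ^+ 2 * y.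
  apply: (@le_trans _ _ ((Phi n * y + (tau * Phi n) ^+ 2 * z) * b)); first exact: ler_pM.
  by rewrite mulrDl -!mulrA lerD// ?ler_wpM2l// ?sqr_ge0.
have h2 : P1 n * p1 n.+1 <= (Phi n * tau * y) * (D n.+1 * tau) by exact: ler_pM.
have h3 : P0 n * p2 n.+1 <= x * D n.+1 by exact: ler_pM.
have h4 : 0 <= (tau * D n.+1) ^+ 2 * y by rewrite mulr_ge0 ?sqr_ge0.
(* The mixed term of the product rule is exactly the cross term in the square of [Phi n + D n.+1];
   only the square of [D n.+1] is given away. *)
have -> : (Phi n + D n.+1) * x + (tau * (Phi n + D n.+1)) ^+ 2 * y =
  (Phi n * x + (tau * Phi n) ^+ 2 * y) + 2 * (Phi n * tau * y * (D n.+1 * tau))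
  + x * D n.+1 + (tau * D n.+1) ^+ 2 * y by ring.
lra.
Qed.

End Recursion.

(** * Fourier inversion *)

Section Inversion.
Variable R : realType.
Local Notation cnt := (@zcounting R).
Local Notation leb := (@lebesgue_measure R).
Local Notation ang k t := (2 * pi * k%:~R * t).
Local Notation D := `[(-(1/2)), (1/2 : R)].

Lemma sin_int_pi (m : int) : sin (pi * m%:~R) = 0 :> R.
Proof.
have h (n : nat) : sin (pi * n%:R) = 0 :> R.
  elim: n => [|n IH]; first by rewrite mulr0 sin0.
  by rewrite -natr1 mulrDr mulr1 sinDpi IH oppr0.
by case: m => n; rewrite ?NegzE ?mulrNz ?mulrN ?sinN ?h ?oppr0.
Qed.

Lemma lebesgue_period : leb [set` D] = 1%E.
Proof.
rewrite lebesgue_measure_itv/= ifT; last by rewrite lte_fin; lra.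
rewrite (_ : (_ + _)%E = ((1 / 2 - - (1 / 2) : R))%:E)//.
by have -> : 1 / 2 - - (1 / 2) = 1 :> R by lra.
Qed.

Lemma integral_cos_int (m : int) :
  (\int[leb]_(t in [set` D]) (cos (ang m t))%:E = (m == 0)%:R%:E)%E.
Proof.
have [->|m0] := eqVneq m 0.
  rewrite (eq_integral (cst 1%E)); last by move=> t _; rewrite mulr0 mul0r cos0.
  by rewrite integral_cst//= lebesgue_period mul1e.
set w : R := 2 * pi * m%:~R.
have w0 : w != 0.
  rewrite /w; apply: mulf_neq0; last by rewrite intr_eq0.
  by apply: mulf_neq0; rewrite ?pnatr_eq0// gt_eqF// pi_gt0.
pose F t := w^-1 * sin (w * t).
have dF (t : R) : is_derive t (1 : R) F (cos (w * t)).
  have dl : is_derive t (1 : R) (fun x : R => w * x) w.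
    apply: is_derive_eq (is_deriveZ w (is_derive_id t (1 : R))) _.
    by rewrite /GRing.scale /= mulr1.
  apply: is_derive_eq (is_deriveZ w^-1 (is_derive1_comp (is_derive_sin (w * t)) dl)) _.
  by rewrite /GRing.scale /= mulrCA mulVf ?mulr1.
have cF t : {for t, continuous F}.
  by apply: differentiable_continuous; apply/derivable1_diffP; exact: ex_derive.
rewrite (@continuous_FTC2 _ (fun t => cos (w * t)) F).
- rewrite /F (_ : w * (1 / 2) = pi * m%:~R); last by rewrite /w; field.
  rewrite (_ : w * - (1 / 2) = - (pi * m%:~R)); last by rewrite /w; field.
  by rewrite sinN sin_int_pi oppr0 mulr0 subee.
- lra.
- apply: continuous_subspaceT => t.
  apply: continuous_comp; last exact: continuous_cos.
  by apply: cvgM; [exact: cvg_cst|exact: cvg_id].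
- split.
  + by move=> t _; exact: ex_derive.
  + exact/cvg_at_right_filter/cF.
  + exact/cvg_at_left_filter/cF.
- by move=> t _; rewrite derive1E; exact: derive_val.
Qed.

(** Fubini for [u j * cos (2 pi (j - k) t)] on the period: integrating in [t] first leaves [u k] by
    orthogonality, summing over [j] first leaves the real part of the transform rotated by a unit
    complex number, which is at most its modulus. *)
Lemma norm_le_integral_hat (u : int -> R) (k : int) (B : R -> R) :
  l1 R u -> measurable_fun setT B ->
  (forall t, t \in D -> cabs R (hat_re u t) (hat_im u t) <= B t) ->
  (`|u k|%:E <= \int[leb]_(t in [set` D]) (B t)%:E)%E.
Proof.
move=> iu mB uB.
pose f (p : R * int) : \bar R :=
  (u p.2 * (cos (ang (p.2 - k) p.1) * \1_[set` D] p.1))%:E.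
have mf : measurable_fun setT f.
  apply/measurable_EFinP; apply: measurable_funM.
    exact: (measurableT_comp (zmeasurable_fun _ _ setT u) measurable_snd).
  apply: measurable_funM; last exact: (measurableT_comp (measurable_indic _) measurable_fst).
  apply: (measurableT_comp (continuous_measurable_fun (@continuous_cos R))).
  apply: measurable_funM; last exact: measurable_fst.
  exact: (measurableT_comp (zmeasurable_fun _ _ setT
    (fun j : int => 2 * pi * (j - k)%:~R : R)) measurable_snd).
have i1 : (\int[leb]_t (\1_[set` D] t)%:E = 1)%E.
  by rewrite integral_indic// setIT; exact: lebesgue_period.
have mI : measurable_fun setT (fun t => (\1_[set` D] t)%:E : \bar R).
  by apply/measurable_EFinP; exact: measurable_indic.
have fint : (leb \x cnt)%E.-integrable setT f.
  apply: (proj2 (@integrable21ltyP _ _ _ _ R leb cnt f mf)).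
  apply: (@le_lt_trans _ _ (\int[cnt]_j `|u j|%:E)%E); last first.
    by move/integrableP : iu => [].
  apply: ge0_le_integral => //; first by move=> j _; exact: integral_ge0.
  move=> j _; apply: (@le_trans _ _ (\int[leb]_t (`|u j|%:E * (\1_[set` D] t)%:E))%E).
    apply: ge0_le_integral => //.
    - apply: measurableT_comp => //.
      exact: (measurableT_comp mf (pair2_measurable j)).
    - exact: emeasurable_funM.
    move=> t _; rewrite /f/= -EFinM lee_fin !normrM ler_wpM2l//.
    by rewrite indicE; case: (t \in _); rewrite ?normr1 ?normr0 ?mulr1 ?mulr0// cos_max.
  by rewrite ge0_integralZl// i1 mule1.
pose b t : R := ang k t.
have FE t : fubini_F cnt f t =
    (\1_[set` D] t * (hat_re u t * cos (b t) + hat_im u t * sin (b t)))%:E.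
  have iuc : l1 R (fun j => u j * cos (ang j t) * (\1_[set` D] t * cos (b t))).
    apply: (l1M _ _ _ `|\1_[set` D] t * cos (b t)|) => //.
    by apply: l1M iu => j; exact: cos_max.
  have ius : l1 R (fun j => u j * sin (ang j t) * (\1_[set` D] t * sin (b t))).
    apply: (l1M _ _ _ `|\1_[set` D] t * sin (b t)|) => //.
    by apply: l1M iu => j; exact: sin_max.
  transitivity ((\int[cnt]_j (u j * cos (ang j t) * (\1_[set` D] t * cos (b t)) +
      u j * sin (ang j t) * (\1_[set` D] t * sin (b t))))%:E).
    rewrite /Rintegral fineK; last by apply: integrable_fin_num => //; exact: l1D.
    apply: eq_integral => j _; rewrite /f /=; congr EFin.
    have -> : ang (j - k) t = ang j t - b t by rewrite intrB /b; ring.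
    by rewrite cosB; ring.
  congr EFin; rewrite RintegralD// !RintegralZr//.
  - by rewrite -hat_reE// -hat_imE//; ring.
  - by apply: l1M iu => j; exact: sin_max.
  - by apply: l1M iu => j; exact: cos_max.
have GE (j : int) : (\int[leb]_t f (t, j) = ((u j) * (j == k)%:R)%:E)%E.
  rewrite /f /=.
  have ic : leb.-integrable setT (fun t => (cos (ang (j - k) t) * \1_[set` D] t)%:E).
    apply: (@le_integrable _ _ _ leb setT measurableT _ (fun t => (\1_[set` D] t)%:E)).
    - apply/measurable_EFinP; apply: measurable_funM => //.
      apply: (measurableT_comp (continuous_measurable_fun (@continuous_cos R))).
      exact: measurable_funM.
    - move=> t _; rewrite lee_fin normrM; apply: ler_piMl => //; exact: cos_max.
    - apply/integrableP; split => //.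
      under eq_integral do rewrite gee0_abs ?lee_fin//.
      by rewrite i1 ltry.
  under eq_integral do rewrite EFinM.
  rewrite integralZl//.
  rewrite (_ : (fun t => _) = (fun t => (cos (ang (j - k) t))%:E) \_ [set` D]); last first.
    apply/funext => t; rewrite patchE indicE; case: ifPn => _ /=; by rewrite ?mulr1 ?mulr0.
  by rewrite -integral_mkcond integral_cos_int subr_eq0.
have uk : (\int[leb]_t fubini_F cnt f t = (u k)%:E)%E.
  rewrite /fubini_F (Fubini fint).
  rewrite (eq_integral ((EFin \o u) \_ [set k])); last first.
    move=> j _; rewrite GE patchE; have [->|jk] := eqVneq j k.
      by rewrite mem_set// mulr1.
    by rewrite memNset ?mulr0// => /eqP; rewrite (negbTE jk).
  rewrite -integral_mkcond (eq_integral (cst (u k)%:E)); last first.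
    by move=> j; rewrite inE /= => ->.
  rewrite integral_cst//= /zcounting /counting asboolT; last exact: finite_set1.
  by rewrite fset_set1 finmap.cardfs1 mule1.
have mF : measurable_fun setT (fubini_F cnt f).
  by have /integrableP[] := integrable_fubini_F fint.
rewrite -[leLHS]/(`|(u k)%:E|)%E -uk.
apply: (le_trans (le_abse_integral leb measurableT mF)).
rewrite [leRHS]integral_mkcond.
apply: ge0_le_integral => //.
- exact: measurableT_comp.
- apply/(measurable_restrictT _ _).1 => //; exact/measurable_EFinP/measurable_funTS.
move=> t _; rewrite FE patchE indicE; case: ifPn => tD /=; last by rewrite mul0r normr0.
rewrite mul1r lee_fin; apply: le_trans (uB t _); last by move: tD; rewrite inE.
have := normr_le_cabs R (hat_re u t * cos (b t) - hat_im u t * (- sin (b t)))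
   (hat_re u t * (- sin (b t)) + hat_im u t * cos (b t)).
by rewrite cabsM cabsNr cabs_cos_sin mulr1 mulrN opprK.
Qed.

(** The integrand is [sqrt (pi / a)] times the normal density of variance [1 / (2 a)], whose
    integral over the whole line is 1. *)
Lemma gauss_integral_le (a : R) : 0 < a ->
  (\int[leb]_(t in [set` D]) (expR (- a * t ^+ 2))%:E <= (Num.sqrt (pi / a))%:E)%E.
Proof.
move=> a0; pose s : R := Num.sqrt (2 * a)^-1.
have s2 : s ^+ 2 = (2 * a)^-1 by rewrite sqr_sqrtr// invr_ge0 mulr_ge0// ltW.
have s0 : s != 0 by rewrite gt_eqF// sqrtr_gt0 invr_gt0 mulr_gt0.
have pa : 0 < pi / a :> R by rewrite divr_gt0// pi_gt0.
have e t : expR (- a * t ^+ 2) = Num.sqrt (pi / a) * normal_pdf 0 s t.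
  rewrite normal_pdfE// /normal_peak /normal_fun s2 subr0.
  rewrite (_ : (2 * a)^-1 * pi *+ 2 = pi / a); last by rewrite mulr2n; field; rewrite gt_eqF.
  rewrite mulVKf ?gt_eqF ?sqrtr_gt0//; congr expR.
  rewrite (_ : (2 * a)^-1 *+ 2 = a^-1); first by rewrite invrK; ring.
  by rewrite mulr2n; field; rewrite gt_eqF.
under eq_integral do rewrite e EFinM.
have mp : measurable_fun setT (EFin \o normal_pdf 0 s).
  by apply/measurable_EFinP; exact: measurable_normal_pdf.
rewrite ge0_integralZl//; last 2 first.
- exact: measurable_funTS.
- by move=> t _; rewrite lee_fin normal_pdf_ge0.
rewrite -[leRHS]mule1 -(integral_normal_pdf 0 s) lee_pmul2l ?lte_fin ?sqrtr_gt0//.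
apply: ge0_subset_integral => //.
by move=> t _; rewrite lee_fin normal_pdf_ge0.
Qed.

End Inversion.

(** * The maximal ergodic theorem *)

Section MaximalErgodic.
Context d (X : measurableType d) (R : realType) (m : probability X R).
Variables (tau : X -> X) (F : X -> R) (lam : R).
Hypothesis mtau : measurable_fun setT tau.
Hypothesis tauP : forall A, measurable A -> m (tau @^-1` A) = m A.
Hypothesis mF : measurable_fun setT F.
Hypothesis F0 : forall x, 0 <= F x.
Hypothesis lam0 : 0 < lam.

(* [garsia n x] is the maximum over [j <= n] of the Birkhoff sums of [F - lam] of length
   [j]; in this recursive form Garsia's inequality is immediate. *)
Fixpoint garsia (n : nat) (x : X) : R :=
  if n is n'.+1 then Num.max 0 (F x - lam + garsia n' (tau x)) else 0.

(** The set where some Birkhoff average of [F] exceeds [lam]. *)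
Definition garsia_set : set X := \bigcup_n [set x | 0 < garsia n x].

Lemma garsia_ge0 n x : 0 <= garsia n x.
Proof. by case: n => [|n] //=; rewrite le_max lexx. Qed.

Lemma garsia_leS n x : garsia n x <= garsia n.+1 x.
Proof.
elim: n x => [|n IH] x; first exact: garsia_ge0.
rewrite [leLHS]/= [leRHS]/= ge_max !le_max lexx/= lerD2l.
by rewrite -/(garsia n.+1 (tau x)) IH orbT.
Qed.

Lemma measurable_garsia n : measurable_fun setT (garsia n).
Proof.
elim: n => [|n IH] /=; first exact: measurable_cst.
apply: measurable_maxr => //; apply: measurable_funD.
  exact: measurable_funB.
exact: (measurableT_comp IH).
Qed.

Lemma measurable_garsia_gt0 n : measurable [set x | 0 < garsia n x].
Proof.
have := measurable_garsia n measurableT _ (measurable_itv `](0 : R), +oo[).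
by rewrite setTI; congr measurable; apply/seteqP; split => x /=;
  rewrite in_itv/= andbT.
Qed.

Lemma ge0_integral_invariant (g : X -> R) : measurable_fun setT g ->
  (forall x, 0 <= g x) ->
  (\int[m]_x (g (tau x))%:E = \int[m]_x (g x)%:E)%E.
Proof.
move=> mg g0.
rewrite -(@ge0_integral_pushforward _ _ _ _ _ _ mtau m setT (EFin \o g)) //=.
- by apply: eq_measure_integral => A mA _; rewrite /= /pushforward tauP.
- exact/measurable_EFinP.
- by move=> x _; rewrite lee_fin.
Qed.

Lemma birkhoff_le_garsia n x :
  \sum_(i < n) (F (iter i tau x) - lam) <= garsia n x.
Proof.
elim: n x => [|n IH] x; first by rewrite big_ord0.
rewrite big_ord_recl/= le_max lerD2l.
apply/orP; right; apply: le_trans (IH (tau x)).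
by apply: ler_sum => i _; rewrite add0n -iterS iterSr.
Qed.

Lemma birkhoff_le n x : ~ garsia_set x ->
  \sum_(i < n) F (iter i tau x) <= lam *+ n.
Proof.
move=> nx; have := birkhoff_le_garsia n x.
rewrite sumrB sumr_const card_ord.
have -> : garsia n x = 0.
  apply/eqP; rewrite eq_le garsia_ge0 andbT leNgt; apply/negP => h.
  by apply: nx; exists n.
by rewrite subr_le0.
Qed.

Lemma measurable_garsia_set : measurable garsia_set.
Proof. by apply: bigcup_measurable => n _; exact: measurable_garsia_gt0. Qed.

Hypothesis iF : (\int[m]_x (F x)%:E < +oo)%E.

(** Finiteness is what permits cancelling this integral from both sides in [garsia_ineq]. *)
Lemma integral_garsia_fin n : (\int[m]_x (garsia n x)%:E < +oo)%E.
Proof.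
elim: n => [|n IH]; first by rewrite integral0_eq// ltry.
apply: (@le_lt_trans _ _ (\int[m]_x ((F x)%:E + (garsia n (tau x))%:E))%E).
  apply: ge0_le_integral => //.
  - by move=> x _; rewrite lee_fin garsia_ge0.
  - by apply/measurable_EFinP; exact: measurable_garsia.
  - apply/measurable_EFinP; apply: measurable_funD => //.
    exact: (measurableT_comp (measurable_garsia n)).
  - move=> x _; rewrite -EFinD lee_fin /= ge_max addr_ge0 ?garsia_ge0//=.
    by rewrite lerD2r gerBl ltW.
rewrite ge0_integralD//.
- rewrite (ge0_integral_invariant _ (measurable_garsia n) (garsia_ge0 n)).
  exact: lte_add_pinfty.
- by move=> x _; rewrite lee_fin.
- exact/measurable_EFinP.
- by move=> x _; rewrite lee_fin garsia_ge0.
- by apply/measurable_EFinP; exact: (measurableT_comp (measurable_garsia n)).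
Qed.

(** Pointwise, [garsia n.+1 + lam * 1_E] is at most [F] plus [garsia n.+1] composed with [tau]. On
    [E] the maximum is its second argument and [garsia] increases with [n]; off [E] the left side is
    0. After integration, invariance makes the two [garsia] terms cancel. *)
Lemma garsia_ineq n :
  (lam%:E * m [set x | (0 < garsia n x)%R] <= \int[m]_x (F x)%:E)%E.
Proof.
case: n => [|n].
  rewrite (_ : [set x | _] = set0) ?measure0 ?mule0 ?integral_ge0//.
    by move=> x _; rewrite lee_fin.
  by apply/seteqP; split=> x //=; rewrite ltxx.
set E := [set x | _].
have mE : measurable E by exact: measurable_garsia_gt0.
have fin1 : (\int[m]_x (garsia n.+1 x)%:E)%E \is a fin_num.
  rewrite ge0_fin_numE ?integral_garsia_fin//.
  by apply: integral_ge0 => x _; rewrite lee_fin garsia_ge0.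
rewrite -(leeD2lE _ _ fin1).
apply: (@le_trans _ _ (\int[m]_x ((garsia n.+1 x)%:E + (lam * \1_E x)%:E))%E).
  rewrite ge0_integralD//.
  - rewrite leeD2l// (_ : (fun x => _) = fun x => (lam%:E * (\1_E x)%:E)%E)//.
    rewrite ge0_integralZl//; last 2 first.
    + exact/measurable_EFinP/measurable_indic.
    + by rewrite lee_fin ltW.
    by rewrite integral_indic// setIT.
  - by move=> x _; rewrite lee_fin garsia_ge0.
  - by apply/measurable_EFinP; exact: measurable_garsia.
  - by move=> x _; rewrite lee_fin mulr_ge0// ltW.
  - by apply/measurable_EFinP; apply: measurable_funM => //; exact: measurable_indic.
apply: (@le_trans _ _ (\int[m]_x ((garsia n.+1 (tau x))%:E + (F x)%:E))%E).
  apply: ge0_le_integral => //.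
  - by move=> x _; rewrite -EFinD lee_fin addr_ge0 ?garsia_ge0 ?mulr_ge0// ltW.
  - apply/measurable_EFinP; apply: measurable_funD; first exact: measurable_garsia.
    by apply: measurable_funM => //; exact: measurable_indic.
  - apply/measurable_EFinP; apply: measurable_funD => //.
    exact: (measurableT_comp (measurable_garsia n.+1)).
  - move=> x _; rewrite -!EFinD lee_fin indicE.
    have [xE|xE] := boolP (x \in E).
      move: (xE); rewrite inE /E /= => h.
      have := garsia_leS n (tau x).
      have -> : Num.max 0 (F x - lam + garsia n (tau x)) = F x - lam + garsia n (tau x).
        by move: h; rewrite lt_max ltxx /= => /ltW/max_idPr.
      rewrite /=; lra.
    have -> : garsia n.+1 x = 0.
      apply/eqP; rewrite eq_le garsia_ge0 andbT leNgt; apply/negP => h.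
      by move: xE; rewrite notin_setE; apply.
    by rewrite mulr0 addr0 addr_ge0 ?garsia_ge0.
rewrite ge0_integralD//.
- by rewrite (ge0_integral_invariant _ (measurable_garsia n.+1) (garsia_ge0 n.+1)).
- by move=> x _; rewrite lee_fin garsia_ge0.
- by apply/measurable_EFinP; exact: (measurableT_comp (measurable_garsia n.+1)).
- by move=> x _; rewrite lee_fin.
- exact/measurable_EFinP.
Qed.

Lemma maximal_ergodic : (lam%:E * m garsia_set <= \int[m]_x (F x)%:E)%E.
Proof.
have nd : nondecreasing_seq (fun n => [set x | 0 < garsia n x]).
  apply/nondecreasing_seqP => n; apply/subsetPset => x /= /lt_le_trans; apply.
  exact: garsia_leS.
have := nondecreasing_cvg_mu (mu := m) measurable_garsia_gt0 measurable_garsia_set nd.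
move=> /(cvgeZl (isT : lam%:E \is a fin_num)) h.
rewrite -(cvg_lim _ h)//; apply: lime_le; first by apply/cvg_ex; eexists; exact: h.
by apply: nearW => n; exact: garsia_ineq.
Qed.

End MaximalErgodic.

(** * Weak type bounds from kernel estimates *)

Section Abel.
Variable R : realType.
Implicit Types (g a : nat -> R) (lam s : R).

Lemma abel_le g a lam N : (forall k, 0 <= g k) -> (forall k, g k.+1 <= g k) ->
  (forall n, \sum_(i < n) a i <= lam *+ n) ->
  \sum_(i < N) g i * a i <= lam * \sum_(i < N) g i.
Proof.
move=> g0 gS ha.
have B0 n : \sum_(i < n) (a i - lam) <= 0.
  by rewrite sumrB sumr_const card_ord subr_le0.
rewrite -subr_le0 mulr_sumr -sumrB.
under eq_bigr do rewrite (mulrC lam) -mulrBr.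
case: N => [|N]; first by rewrite big_ord0.
(* This sharper bound is the one that passes the induction: the partial sums are nonpositive, so
   replacing [g N] by the smaller [g N.+1] increases the product. *)
apply: (@le_trans _ _ (g N * \sum_(i < N.+1) (a i - lam))); last first.
  by rewrite mulr_ge0_le0.
elim: N => [|N IH]; first by rewrite !big_ord_recr !big_ord0/= !add0r.
rewrite [X in X <= _]big_ord_recr [X in _ <= _ * X]big_ord_recr /= [leRHS]mulrDr lerD2r.
by apply: le_trans IH _; rewrite ler_wnM2r.
Qed.

(* Equals [s / (s + k) - s / (s + k + 1)], so its sums telescope. *)
Definition hker s (k : nat) : R := s / ((s + k%:R) * (s + k%:R + 1)).

Lemma hker_ge0 s k : 0 < s -> 0 <= hker s k.
Proof.
move=> s0; have k0 : 0 <= k%:R :> R by [].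
by apply: divr_ge0; [lra|apply: mulr_ge0; lra].
Qed.

Lemma hkerS s k : 0 < s -> hker s k.+1 <= hker s k.
Proof.
move=> s0; have k0 : 0 <= k%:R :> R by [].
have -> : hker s k.+1 = s / ((s + k%:R + 1) * (s + k%:R + 2)).
  by rewrite /hker -natr1 -!addrA.
rewrite /hker ler_pM2l// lef_pV2 ?posrE; last 2 first.
- by apply: mulr_gt0; lra.
- by apply: mulr_gt0; lra.
by rewrite mulrC ler_pM2l; lra.
Qed.

Lemma sum_hker_le1 s N : 0 < s -> \sum_(i < N) hker s i <= 1.
Proof.
move=> s0.
suff -> : \sum_(i < N) hker s i = 1 - s / (s + N%:R).
  by rewrite gerBl divr_ge0 ?addr_ge0// ltW.
elim: N => [|N IH]; first by rewrite big_ord0 addr0 divff ?subrr// gt_eqF.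
rewrite big_ord_recr /= IH /hker -natr1.
have N0 : 0 <= N%:R :> R by [].
field.
by apply/andP; split; rewrite gt_eqF//; lra.
Qed.

(** The kernel [g] need not be monotone, so [abel_le] is applied to its decreasing majorant. *)
Lemma abel_hker (g a : nat -> R) c s lam N : 0 < s -> 0 <= c -> 0 <= lam ->
  (forall k, 0 <= a k) ->
  (forall k, `|g k| <= c * hker s k) -> (forall n, \sum_(i < n) a i <= lam *+ n) ->
  \sum_(i < N) `|g i| * a i <= c * lam.
Proof.
move=> s0 c0 l0 a0 gh ha.
apply: (@le_trans _ _ (c * \sum_(i < N) hker s i * a i)).
  rewrite mulr_sumr; apply: ler_sum => i _; rewrite mulrA.
  exact: ler_wpM2r.
rewrite ler_wpM2l//.
apply: (le_trans (abel_le _ _ _ N (fun k => hker_ge0 s k s0) (fun k => hkerS s k s0) ha)).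
by rewrite ler_piMr// sum_hker_le1.
Qed.

Lemma sym_psum_split (u : int -> R) N :
  sym_psum u N = \sum_(i < N.+1) u i%:Z + \sum_(i < N) u (Negz i).
Proof.
rewrite /sym_psum; elim: N => [|N IH].
  by rewrite !big_ord_recr !big_ord0 /= subr0 addr0.
rewrite (_ : (2 * N.+1).+1 = (2 * N).+1.+2)%N; last by lia.
rewrite big_ord_recl [in LHS]big_ord_recr /=.
have -> : \sum_(i < (2 * N).+1) u ((bump 0 i)%:Z - (N.+1)%:Z) =
          \sum_(i < (2 * N).+1) u (i%:Z - N%:Z).
  by apply: eq_bigr => i _; congr u; rewrite /bump /=; lia.
rewrite IH [in RHS]big_ord_recr [X in _ = _ + X]big_ord_recr /=.
have -> : 0%:Z - (N.+1)%:Z = Negz N by rewrite NegzE; lia.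
have -> : (bump 0 (2 * N).+1)%:Z - (N.+1)%:Z = N.+1%:Z by rewrite /bump /=; lia.
by ring.
Qed.

End Abel.

Section WeakType.
Context d (X : measurableType d) (R : realType) (m : probability X R).
Variables (tau tau' : X -> X).

Lemma mu_op_bound (mu : int -> R) (f : X -> R) (c s lam : R) x :
  0 < s -> 0 <= c -> 0 <= lam ->
  (forall k, `|mu k| <= c * hker R s (absz k)) ->
  (forall n, \sum_(i < n) `|f (iter i tau x)| <= lam *+ n) ->
  (forall n, \sum_(i < n) `|f (iter i tau' x)| <= lam *+ n) ->
  `|mu_op tau tau' mu f x| <= 2 * c * lam.
Proof.
move=> s0 c0 l0 muh h1 h2.
have hb N : `|sym_psum (fun k => mu k * f (tauz tau tau' k x)) N| <= 2 * c * lam.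
  rewrite sym_psum_split (le_trans (ler_normD _ _))//.
  rewrite (_ : 2 * c * lam = c * lam + c * lam); last by ring.
  apply: lerD.
    apply: (le_trans (ler_norm_sum _ _ _)).
    under eq_bigr do rewrite normrM /=.
    by apply: (abel_hker R (fun i => mu i%:Z) (fun i => `|f (iter i tau x)|) c s).
  apply: (le_trans (ler_norm_sum _ _ _)).
  under eq_bigr do rewrite normrM /= -iterS.
  (* [Negz j] is [-(j + 1)] and goes with the iterate [j.+1] of [tau']. A zero term at index 0 makes
     the sum start at [x] itself, as the averages in the hypothesis do. *)
  pose g i := if i is j.+1 then mu (Negz j) else 0.
  apply: (@le_trans _ _ (\sum_(i < N.+1) `|g i| * `|f (iter i tau' x)|)).
    by rewrite big_ord_recl /= normr0 mul0r add0r.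
  apply: (abel_hker R g (fun i => `|f (iter i tau' x)|) c s) => // -[|k] /=.
    by rewrite normr0 mulr_ge0// hker_ge0.
  exact: (muh (Negz k)).
(* Where the sum diverges its value is 0 and the bound is trivial; elsewhere the bound on partial
   sums passes to the limit. *)
rewrite /mu_op /zsum; case: pselect => [cv|nc] /=; last first.
  by rewrite normr0 mulr_ge0// mulr_ge0.
pose v := sym_psum (fun k => mu k * f (tauz tau tau' k x)).
have cn : `|v n| @[n --> \oo] --> `|limn v| by exact: cvg_norm cv.
rewrite -(cvg_lim _ cn)//.
apply: limr_le; first by apply/cvg_ex; eexists; exact: cn.
by apply: nearW => N; exact: hb.
Qed.

(** The partial sums may diverge at some points, so [zsum] is rewritten with a measurable test:
    their upper and lower limits agree and are finite. *)
Lemma measurable_zsum (u : int -> X -> R) :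
  (forall k, measurable_fun setT (u k)) ->
  measurable_fun setT (fun x => zsum (u ^~ x)).
Proof.
move=> mu.
pose G n x := sym_psum (u ^~ x) n.
have mG n : measurable_fun setT (EFin \o G n).
  by apply/measurable_EFinP; apply: measurable_sum.
pose E x := limn_esup (fun n => (EFin \o G n) x).
pose I x := limn_einf (fun n => (EFin \o G n) x).
have mE : measurable_fun setT E by exact: measurable_fun_limn_esup.
have mI : measurable_fun setT I.
  have -> : I = fun x => (- limn_esup (fun n => (EFin \o (fun x => (- G n x)%R)) x))%E.
    by apply/funext => x; rewrite /I -limn_einfN; congr limn_einf; apply/funext => n /=; rewrite opprK.
  apply: measurableT_comp => //; apply: measurable_fun_limn_esup => n.
  by apply/measurable_EFinP; apply: measurable_funN; apply/measurable_EFinP.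
have -> : (fun x => zsum (u ^~ x)) =
    (fun x => if (E x == I x) && (E x \is a fin_num) then fine (E x) else 0).
  apply/funext => x; rewrite /zsum; case: pselect => [cv|nc] /=.
    have cE : (fun n => (EFin \o G n) x) @ \oo --> (limn (fun n => G n x))%:E.
      by apply: cvg_EFin; [exact: nearW|exact: cv].
    have icE : cvgn (fun n => (EFin \o G n) x) by apply/cvg_ex; eexists; exact: cE.
    rewrite /E /I is_cvg_limn_esupE// is_cvg_limn_einfE// eqxx /=.
    by rewrite (cvg_lim _ cE).
  case: ifPn => // /andP[/eqP EI Efin]; exfalso; apply: nc.
  apply/cvg_ex; exists (fine (E x)).
  apply: (fine_cvg (f := fun n => (EFin \o G n) x)); rewrite fineK//.
  apply: (@squeeze_cvge _ _ _ _ (einfs (fun n => (EFin \o G n) x)) _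
          (esups (fun n => (EFin \o G n) x))).
  - by apply: nearW => n; apply/andP; split; [apply: ereal_inf_lbound|apply: ereal_sup_ubound]; exists n => /=.
  - rewrite EI /I limn_einf_lim; exact: is_cvg_einfs.
  - rewrite /E limn_esup_lim; exact: is_cvg_esups.
apply: measurable_fun_ifT => //.
- apply: measurable_and; first exact: measurable_fun_eqe.
  apply: (measurable_fun_bool true); rewrite setTI.
  by have := emeasurable_fin_num measurableT mE; rewrite setTI.
- exact: measurableT_comp.
Qed.

Lemma weak_type_of_kernel (mu : nat -> int -> R) (s : nat -> R) (c : R) :
  inv_mp m tau tau' -> 0 < c -> (forall n, (1 <= n)%N -> 0 < s n) ->
  (forall n k, (1 <= n)%N -> `|mu n k| <= c * hker R (s n) (absz k)) ->
  forall f : X -> R, m.-integrable setT (EFin \o f) ->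
  forall lam : R, 0 < lam ->
    (m [set x | lam%:E < ereal_sup [set (`|mu_op tau tau' (mu n) f x|)%:E
        | n in [set n : nat | (1 <= n)%N]]]
     <= (4 * c / lam)%:E * \int[m]_x (`|f x|)%:E)%E.
Proof.
move=> [mtau mtau' tK t'K tP] c0 s0 muh f fint lam lam0.
(* Chosen so that the bound [2 * c * lam'] of [mu_op_bound] is [lam]. Each of the two directions
   costs [1 / lam' = 2 * c / lam], whence the constant [4 * c]. *)
pose F x := `|f x|; pose lam' := lam / (2 * c).
have lam'0 : 0 < lam' by rewrite divr_gt0// mulr_gt0.
have mf : measurable_fun setT f by move/integrableP: fint => [/measurable_EFinP].
have mF : measurable_fun setT F by exact: measurableT_comp.
have F0 x : 0 <= F x by exact: normr_ge0.
have iF : (\int[m]_x (F x)%:E < +oo)%E by move/integrableP: fint => [].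
have t'P A : measurable A -> m (tau' @^-1` A) = m A.
  move=> mA; rewrite -[in RHS](_ : tau @^-1` (tau' @^-1` A) = A).
    by rewrite tP// -[X in measurable X]setTI; exact: mtau'.
  by apply/seteqP; split => x /=; rewrite tK.
have [mE mE'] := (measurable_garsia_set _ X R tau F lam' mtau mF,
  measurable_garsia_set _ X R tau' F lam' mtau' mF).
have hE := maximal_ergodic _ X R m tau F lam' mtau tP mF F0 lam'0 iF.
have hE' := maximal_ergodic _ X R m tau' F lam' mtau' t'P mF F0 lam'0 iF.
set E := garsia_set _ _ _ _ _ _ in mE hE; set E' := garsia_set _ _ _ _ _ _ in mE' hE'.
set A := [set x | _].
have AE : A = \bigcup_(n in [set n : nat | (1 <= n)%N])
    [set x | lam < `|mu_op tau tau' (mu n) f x|].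
  apply/seteqP; split=> x /=.
    by move=> /ereal_sup_gt[_ [n /= n1 <-]]; rewrite lte_fin => h; exists n.
  move=> [n /= n1 h]; apply: (@lt_le_trans _ _ (`|mu_op tau tau' (mu n) f x|)%:E).
    by rewrite lte_fin.
  by apply: ereal_sup_ubound; exists n.
have mtz k : measurable_fun setT (tauz tau tau' k).
  have mi (g : X -> X) n : measurable_fun setT g -> measurable_fun setT (iter n g).
    move=> mg; elim: n => [|n IH]; first exact: measurable_id.
    exact: (measurableT_comp mg IH).
  by case: k => n; exact: mi.
have mA : measurable A.
  rewrite AE; apply: bigcup_measurable => n _.
  have mop : measurable_fun setT (fun x => `|mu_op tau tau' (mu n) f x|).
    apply: measurableT_comp => //; apply: measurable_zsum => k.
    apply: measurable_funM => //; exact: (measurableT_comp mf (mtz k)).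
  have := mop measurableT _ (measurable_itv `]lam, +oo[).
  rewrite setTI; congr measurable; apply/seteqP; split => x /=;
    by rewrite in_itv/= andbT.
have AEE : A `<=` E `|` E'.
  rewrite AE => x [n /= n1]; apply: contraPP => /not_orP[nE nE'].
  apply/negP; rewrite -leNgt.
  have -> : lam = 2 * c * lam' by rewrite /lam'; field; rewrite gt_eqF.
  apply: (mu_op_bound (mu n) f c (s n) lam') => //.
  - exact: s0.
  - exact: ltW.
  - exact: ltW.
  - by move=> k; exact: muh.
  - move=> N; exact: (birkhoff_le _ _ _ tau F lam' N x nE).
  - move=> N; exact: (birkhoff_le _ _ _ tau' F lam' N x nE').
have bd B : (lam'%:E * m B <= \int[m]_x (F x)%:E)%E ->
    (m B <= (2 * c / lam)%:E * \int[m]_x (F x)%:E)%E.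
  have -> : (2 * c / lam) = lam'^-1 by rewrite /lam' invf_div.
  by move=> h; rewrite muleC lee_pdivlMr// muleC.
apply: (le_trans (le_measure m (mem_set mA) (mem_set (measurableU _ _ mE mE')) AEE)).
apply: (le_trans (measureU2 m mE mE')).
rewrite (_ : 4 * c / lam = 2 * c / lam + 2 * c / lam); last by field; rewrite gt_eqF.
have p0 : 0 <= 2 * c / lam by rewrite divr_ge0 ?mulr_ge0// ltW.
rewrite EFinD ge0_muleDl ?lee_fin//.
by apply: leeD; exact: bd.
Qed.

End WeakType.

(** * Moments of probability measures on the integers *)

Section Estimates.
Variable R : realType.
Implicit Types (a b c t x y C : R).

(** The [M] missing factors cost at most [exp (C M t^2)], and [t^2 <= 1/4] on the period. *)
Lemma expR_pow_le C t (n M : nat) : 0 <= C -> t ^+ 2 <= 4^-1 ->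
  expR (- C * t ^+ 2) ^+ (n - M) <=
  expR (C * M%:R / 4) * expR (- (C * n%:R) * t ^+ 2).
Proof.
move=> C0 t4.
rewrite -expRM_natl -expRD ler_expR.
have h : n%:R <= (n - M)%:R + M%:R :> R by rewrite -natrD ler_nat; lia.
have t0 : 0 <= t ^+ 2 by exact: sqr_ge0.
have h1 : 0 <= (C * t ^+ 2) * ((n - M)%:R + M%:R - n%:R).
  by apply: mulr_ge0; [exact: mulr_ge0|rewrite subr_ge0].
have h2 : 0 <= (C * M%:R) * (4^-1 - t ^+ 2).
  by apply: mulr_ge0; [exact: mulr_ge0|rewrite subr_ge0].
rewrite -subr_ge0.
have -> : C * M%:R / 4 + - (C * n%:R) * t ^+ 2 - (n - M)%:R * (- C * t ^+ 2) =
  (C * t ^+ 2) * ((n - M)%:R + M%:R - n%:R) + (C * M%:R) * (4^-1 - t ^+ 2).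
  by field.
exact: addr_ge0.
Qed.

(** Half of the exponent is spent on [y], since [z * exp (- z) <= 1] for [z = b y / 2]. *)
Lemma poly_gauss_le b c y : 0 < b -> 0 <= c -> 0 <= y ->
  (1 + c * y) * expR (- b * y) <= (1 + 2 * c / b) * expR (- (b / 2) * y).
Proof.
move=> b0 c0 y0.
have -> : - b * y = - (b / 2) * y + - (b / 2) * y by field.
rewrite expRD mulrA; apply: ler_wpM2r; first exact: expR_ge0.
set e := expR _.
have e0 : 0 < e by exact: expR_gt0.
have by0 : 0 <= b / 2 * y by rewrite mulr_ge0// divr_ge0// ltW.
have e1 : e <= 1 by rewrite -[leRHS]expR0 ler_expR mulNr oppr_le0.
have ye : (b / 2 * y) * e <= 1.
  rewrite /e mulNr expRN ler_pdivrMr ?expR_gt0// mul1r.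
  apply: le_trans (expR_ge1Dx _); lra.
rewrite mulrDl mul1r; apply: lerD => //.
have -> : c * y * e = (2 * c / b) * (b / 2 * y * e) by field; rewrite gt_eqF.
by rewrite ler_piMr// divr_ge0 ?mulr_ge0// ltW.
Qed.

(** As [s >= 1], the denominator of [hker] is at most [2 (s + k)^2], hence at most
    [4 (s^2 + k^2)]. *)
Lemma hker_le (mu s A : R) (k : nat) : 1 <= s -> 0 <= mu -> 0 <= A ->
  mu * (s ^+ 2 + k%:R ^+ 2) <= A * s -> mu <= 4 * A * hker R s k.
Proof.
move=> s1 mu0 A0 h.
have k0 : 0 <= k%:R :> R by [].
have d0 : 0 < (s + k%:R) * (s + k%:R + 1) by apply: mulr_gt0; lra.
rewrite /hker mulrA ler_pdivlMr//.
have h1 : (s + k%:R) * (s + k%:R + 1) <= 4 * (s ^+ 2 + k%:R ^+ 2).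
  have h2 : (s + k%:R) * (s + k%:R + 1) <= 2 * (s + k%:R) ^+ 2.
    by rewrite expr2 mulrCA ler_pM2l; lra.
  apply: (le_trans h2).
  have := sqr_ge0 (s - k%:R); rewrite sqrrB sqrrD; lra.
apply: (le_trans (ler_wpM2l mu0 h1)); rewrite mulrCA -mulrA.
by rewrite ler_pM2l.
Qed.

End Estimates.

(** * Transforms and derivatives under a second moment condition *)

Section Moments.
Variable R : realType.
Local Notation cnt := (@zcounting R).
Implicit Types (u v nu : int -> R) (t : R).

Definition hat_mod u t := cabs R (hat_re u t) (hat_im u t).

Lemma hat_mod_ge0 u t : 0 <= hat_mod u t. Proof. exact: cabs_ge0. Qed.

Lemma hat_mod_conv u v t : l1 R u -> l1 R v ->
  hat_mod (Defs.conv u v) t = hat_mod u t * hat_mod v t.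
Proof. by move=> iu iv; rewrite /hat_mod hat_re_conv// hat_im_conv// cabsM. Qed.

Lemma hat_modD u v t : l1 R u -> l1 R v ->
  hat_mod (fun k => u k + v k) t <= hat_mod u t + hat_mod v t.
Proof. by move=> iu iv; rewrite /hat_mod hat_reD// hat_imD//; exact: cabsD. Qed.

(** Reflection conjugates the transform of a real sequence. This reaches the endpoint [1/2], outside
    the half-open interval of the decay hypothesis. *)
Lemma hat_modN u t : l1 R u -> hat_mod u (- t) = hat_mod u t.
Proof.
move=> iu; rewrite /hat_mod !hat_reE// !hat_imE//.
have -> : \int[cnt]_k (u k * cos (2 * pi * k%:~R * - t)) =
    \int[cnt]_k (u k * cos (2 * pi * k%:~R * t)).
  by apply: eq_Rintegral => k _; rewrite mulrN cosN.
have -> : \int[cnt]_k (u k * sin (2 * pi * k%:~R * - t)) =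
    - \int[cnt]_k (u k * sin (2 * pi * k%:~R * t)).
  rewrite -[RHS]mulN1r -RintegralZl//; last by apply: l1M iu => k; exact: sin_max.
  by apply: eq_Rintegral => k _; rewrite mulrN sinN mulrN mulN1r.
exact: cabsNr.
Qed.

Lemma kapD u v : kap R (fun k => u k + v k) = fun k => kap R u k + kap R v k.
Proof. by apply/funext => k; rewrite /kap mulrDr. Qed.

(** The first moment lies between the others: [w <= 1 + w^2]. *)
Lemma l1_kap u : l1 R u -> l1 R (kap R (kap R u)) -> l1 R (kap R u).
Proof.
move=> iu ikk; apply: l1_le (l1D _ _ _ (l1_norm _ _ iu) (l1_norm _ _ ikk)) => k.
rewrite [leRHS]ger0_norm ?addr_ge0//.
rewrite /kap !normrM; set w := `|2| * `|pi| * `|k%:~R|.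
have w0 : 0 <= w by rewrite !mulr_ge0.
have u0 := normr_ge0 (u k).
have h : w * `|u k| <= (1 + w * w) * `|u k|.
  by rewrite ler_wpM2r//; have := sqr_ge0 (w - 1); rewrite sqrrB expr2; nra.
by rewrite (le_trans h)// mulrDl mul1r mulrA.
Qed.

Lemma kap_kap_conv u v : l1 R u -> l1 R (kap R u) -> l1 R (kap R (kap R u)) ->
  l1 R v -> l1 R (kap R v) -> l1 R (kap R (kap R v)) ->
  kap R (kap R (Defs.conv u v)) = fun k =>
    (Defs.conv (kap R (kap R u)) v k + Defs.conv (kap R u) (kap R v) k) +
    (Defs.conv (kap R u) (kap R v) k + Defs.conv u (kap R (kap R v)) k).
Proof. by move=> *; rewrite kap_conv// kapD !kap_conv. Qed.

Lemma prob_l1 nu : is_prob nu -> l1 R nu.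
Proof.
move=> [nu0 nu1]; apply/integrableP; split => //.
under eq_integral do rewrite gee0_abs ?lee_fin//.
by apply: le_lt_trans (ge0_integral_le_esum _ _ nu0) _; rewrite nu1 ltry.
Qed.

Lemma prob_integral_le1 nu : is_prob nu -> \int[cnt]_k `|nu k| <= 1.
Proof.
move=> pnu; have [nu0 nu1] := pnu.
rewrite -lee_fin /Rintegral fineK; last exact: integrable_fin_num (l1_norm _ _ (prob_l1 _ pnu)).
under eq_integral do rewrite ger0_norm//.
by rewrite -nu1 ge0_integral_le_esum.
Qed.

Lemma m2_ge0 nu : (forall k, 0 <= nu k) -> (0 <= m2 nu)%E.
Proof. by move=> nu0; apply: esum_ge0 => k _; rewrite lee_fin mulr_ge0 ?sqr_ge0. Qed.

Lemma kap_kapE nu k : kap R (kap R nu) k = (2 * pi) ^+ 2 * (k%:~R ^+ 2 * nu k).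
Proof. by rewrite /kap; ring. Qed.

Lemma m2_l1 nu : (forall k, 0 <= nu k) -> (m2 nu < +oo)%E -> l1 R (kap R (kap R nu)).
Proof.
move=> nu0 m2nu.
have -> : kap R (kap R nu) = fun k => (2 * pi) ^+ 2 * (k%:~R ^+ 2 * nu k).
  by apply/funext => k; exact: kap_kapE.
have p0 k : 0 <= k%:~R ^+ 2 * nu k by rewrite mulr_ge0 ?sqr_ge0.
apply: l1Z; apply/integrableP; split => //.
under eq_integral do rewrite gee0_abs ?lee_fin//.
exact: le_lt_trans (ge0_integral_le_esum _ _ p0) m2nu.
Qed.

Lemma m2_integral_le nu : (forall k, 0 <= nu k) -> (m2 nu < +oo)%E ->
  ((\int[cnt]_k `|kap R (kap R nu) k|)%:E <= ((2 * pi) ^+ 2)%:E * m2 nu)%E.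
Proof.
move=> nu0 m2nu.
have p0 k : 0 <= k%:~R ^+ 2 * nu k by rewrite mulr_ge0 ?sqr_ge0.
rewrite /Rintegral fineK; last exact: integrable_fin_num (l1_norm _ _ (m2_l1 _ nu0 m2nu)).
have e k : (`|kap R (kap R nu) k|%:E = ((2 * pi) ^+ 2)%:E * (k%:~R ^+ 2 * nu k)%:E)%E.
  by rewrite kap_kapE ger0_norm ?EFinM//; apply: mulr_ge0 => //; exact: sqr_ge0.
under eq_integral do rewrite e.
rewrite ge0_integralZl ?lee_fin ?sqr_ge0//.
- apply: lee_wpmul2l; first by rewrite lee_fin sqr_ge0.
  exact: ge0_integral_le_esum.
- by move=> k _; rewrite lee_fin.
Qed.

Lemma derive1_hat u t : l1 R u -> l1 R (kap R u) ->
  derive1 (hat_re u) t = - hat_im (kap R u) t /\ derive1 (hat_im u) t = hat_re (kap R u) t.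
Proof.
move=> iu ik; rewrite !derive1E; split.
  exact: (@derive_val _ _ _ _ _ _ _ (is_derive_hat_re _ u t iu ik)).
exact: (@derive_val _ _ _ _ _ _ _ (is_derive_hat_im _ u t iu ik)).
Qed.

Lemma derive2_hat u t : l1 R u -> l1 R (kap R u) -> l1 R (kap R (kap R u)) ->
  [/\ derivable (hat_re u) t 1, derivable (derive1 (hat_re u)) t 1,
      derivable (hat_im u) t 1, derivable (derive1 (hat_im u)) t 1 &
      hat_dd_abs u t = hat_mod (kap R (kap R u)) t].
Proof.
move=> iu ik ikk.
have e1 : derive1 (hat_re u) = \- hat_im (kap R u).
  by apply/funext => x; rewrite (derive1_hat u x iu ik).1.
have e2 : derive1 (hat_im u) = hat_re (kap R u).
  by apply/funext => x; rewrite (derive1_hat u x iu ik).2.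
have d1 := is_derive_hat_re _ u t iu ik.
have d2 := is_derive_hat_im _ u t iu ik.
have d3 := is_derive_hat_re _ (kap R u) t ik ikk.
have d4 := is_deriveN (is_derive_hat_im _ (kap R u) t ik ikk).
rewrite e1 e2; split.
- exact: (@ex_derive _ _ _ _ _ _ _ d1).
- exact: (@ex_derive _ _ _ _ _ _ _ d4).
- exact: (@ex_derive _ _ _ _ _ _ _ d2).
- exact: (@ex_derive _ _ _ _ _ _ _ d3).
rewrite /hat_dd_abs /derive1n /= e1 e2 !derive1E.
rewrite (@derive_val _ _ _ _ _ _ _ d4) (@derive_val _ _ _ _ _ _ _ d3).
by rewrite /hat_mod /cabs !sqrrN.
Qed.

Lemma l1_dirac0 : l1 R (@Defs.dirac0 R).
Proof.
have -> : @Defs.dirac0 R = \1_[set 0].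
  apply/funext => k; rewrite /Defs.dirac0 indicE; have [->|k0] := eqVneq k 0.
    by rewrite mem_set.
  by rewrite memNset// => /eqP; rewrite (negbTE k0).
apply/integrableP; split => //.
under eq_integral do rewrite gee0_abs ?lee_fin//.
rewrite integral_indic//= setIT /zcounting /counting asboolT ?ltry//.
Qed.

Lemma kap_dirac0 : kap R (@Defs.dirac0 R) = fun=> 0.
Proof.
by apply/funext => k; rewrite /kap /Defs.dirac0; case: eqP => [->|_]; rewrite ?mulr0 ?mul0r.
Qed.

Lemma kap0 : kap R (fun=> 0) = fun=> 0.
Proof. by apply/funext => k; rewrite /kap mulr0. Qed.

Lemma l10 : l1 R (fun=> 0).
Proof. by rewrite -kap_dirac0; apply: (l1_le _ _ _ _ l1_dirac0) => k; rewrite kap_dirac0 normr0. Qed.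

Lemma hat_mod0 t : hat_mod (fun=> 0) t <= 0.
Proof.
apply: (le_trans (cabs_hat_le _ _ _ l10)).
by under eq_Rintegral do rewrite normr0; rewrite Rintegral_cst// mul0r.
Qed.

Lemma hat_mod_dirac0 t : hat_mod (@Defs.dirac0 R) t <= 1.
Proof.
apply: (le_trans (cabs_hat_le _ _ _ l1_dirac0)).
rewrite -lee_fin /Rintegral fineK; last exact: integrable_fin_num (l1_norm _ _ l1_dirac0).
rewrite (eq_integral (fun k : int => (\1_[set (0 : int)] k : R)%:E)); last first.
  move=> k _; rewrite /Defs.dirac0 indicE; have [->|k0] := eqVneq k 0.
    by rewrite mem_set// normr1.
  by rewrite memNset ?normr0// => /eqP; rewrite (negbTE k0).
rewrite integral_indic//= setIT /zcounting /counting asboolT; last exact: finite_set1.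
by rewrite fset_set1 finmap.cardfs1.
Qed.

End Moments.

(** * Gaussian decay of the convolution products *)

Lemma measurable_hat_mod (R : realType) (u : int -> R) :
  measurable_fun setT (hat_mod R u).
Proof.
have mang (k : int) : measurable_fun setT (fun t : R => 2 * pi * k%:~R * t).
  exact: measurable_funM.
have mre : measurable_fun setT (hat_re u).
  apply: measurable_zsum => k; apply: measurable_funM => //.
  exact: (measurableT_comp (continuous_measurable_fun (@continuous_cos R))).
have mim : measurable_fun setT (hat_im u).
  apply: measurable_zsum => k; apply: measurable_funM => //.
  exact: (measurableT_comp (continuous_measurable_fun (@continuous_sin R))).
apply: (measurableT_comp (continuous_measurable_fun (@sqrt_continuous R))).
by apply: measurable_funD; exact: measurable_funX.
Qed.

Section GaussianDecay.
Variable R : realType.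
Local Notation cnt := (@zcounting R).
Variables (nu : nat -> int -> R) (K C : R) (N0 : nat).
Hypothesis Hprob : forall n, (1 <= n)%N -> is_prob (nu n).
Hypothesis Hmean : forall n, (1 <= n)%N ->
  sym_psum (fun k => k%:~R * nu n k) @ \oo --> (0 : R).
Hypothesis HK : forall n, (1 <= n)%N ->
  (\sum_(1 <= i < n.+1) m2 (nu i) <= (K * n%:R)%:E)%E.
Hypothesis C0 : 0 < C.
Hypothesis Hdecay : forall n, (N0 < n)%N -> forall t : R, -(1/2) <= t < 1/2 ->
  hat_abs (nu n) t <= expR (- C * t ^+ 2).

Local Notation mu := (Defs.convn nu).
(** With the factor 2 of [cabs_hat_mean0_le], the same number bounds the second derivative of the
    transform and, times [|t|], the first. *)
Local Notation D n := (2 * \int[cnt]_k `|kap R (kap R (nu n)) k|).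

Lemma step_ge0 n k : 0 <= nu n.+1 k.
Proof. by have [+ _] := Hprob n.+1 isT. Qed.

Lemma step_m2_fin n : (m2 (nu n.+1) < +oo)%E.
Proof.
apply: le_lt_trans (ltry (K * n.+1%:R)); apply: le_trans (HK n.+1 isT).
rewrite big_nat_recr//= -[leLHS]add0e; apply: leeD => //.
by rewrite big_add1; apply: sume_ge0 => i _; apply: m2_ge0; exact: step_ge0.
Qed.

Lemma step_l1 n :
  [/\ l1 R (nu n.+1), l1 R (kap R (nu n.+1)) & l1 R (kap R (kap R (nu n.+1)))].
Proof.
have i0 := prob_l1 _ _ (Hprob n.+1 isT).
have i2 := m2_l1 _ _ (step_ge0 n) (step_m2_fin n).
by split => //; exact: l1_kap.
Qed.

Lemma step_mean0 n : \int[cnt]_k kap R (nu n.+1) k = 0.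
Proof.
have [_ i1 _] := step_l1 n.
have h := sym_psum_cvg _ _ i1.
rewrite -(cvg_lim _ h)//.
have -> : sym_psum (kap R (nu n.+1)) =
    (fun N => 2 * pi * sym_psum (fun k => k%:~R * nu n.+1 k) N).
  apply/funext => N; rewrite /sym_psum mulr_sumr; apply: eq_bigr => i _.
  by rewrite /kap mulrA.
apply/cvg_lim => //; rewrite -[X in _ --> X](mulr0 (2 * pi : R)).
by apply: cvgMr; exact: Hmean.
Qed.

Lemma sum_D_le n : (1 <= n)%N ->
  \sum_(1 <= i < n.+1) D i <= 2 * ((2 * pi) ^+ 2 * (K * n%:R)).
Proof.
move=> n1; rewrite -mulr_sumr ler_pM2l// -lee_fin.
apply: (@le_trans _ _ (((2 * pi) ^+ 2)%:E * \sum_(1 <= i < n.+1) m2 (nu i))%E); last first.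
  rewrite [leRHS]EFinM; apply: lee_wpmul2l; first by rewrite lee_fin sqr_ge0.
  exact: HK.
rewrite !big_add1 /= -sumEFin ge0_sume_distrr; last first.
  by move=> i _; apply: m2_ge0; exact: step_ge0.
by apply: lee_sum => i _; apply: m2_integral_le; [exact: step_ge0|exact: step_m2_fin].
Qed.

Lemma convn_l1 n : [/\ l1 R (mu n), l1 R (kap R (mu n)) & l1 R (kap R (kap R (mu n)))].
Proof.
elim: n => [|n [i0 i1 i2]].
  by rewrite /= !kap_dirac0 kap0; split; [exact: l1_dirac0|exact: l10|exact: l10].
have [j0 j1 j2] := step_l1 n.
split; first exact: l1_conv.
- by rewrite /= kap_conv//; apply: l1D; exact: l1_conv.
- by rewrite /= kap_kap_conv//; apply: l1D; apply: l1D; exact: l1_conv.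
Qed.

Lemma convn_ge0 n k : 0 <= mu n k.
Proof.
elim: n k => [|n IH] k; first by rewrite /= /Defs.dirac0; case: ifP.
have [i0 _ _] := convn_l1 n; have [j0 _ _] := step_l1 n.
rewrite /= convE//; apply: Rintegral_ge0 => j _.
by rewrite mulr_ge0// step_ge0.
Qed.

(** [W] pays for at most [N0.+2] factors without decay, [K' * n] bounds the sum of the [D i], and
    the last factor of [B] is the constant of [poly_gauss_le] for [b = C] and [c = K']. *)
Let W := expR (C * N0.+2%:R / 4).
Let K' := 2 * ((2 * pi) ^+ 2 * K).
Let B := W * K' * (1 + 2 * K' / C).

Lemma W_gt0 : 0 < W. Proof. exact: expR_gt0. Qed.

Lemma K'_ge0 : 0 <= K'.
Proof.
have := sum_D_le 1 isT; rewrite mulr1; apply: le_trans.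
rewrite big_nat1 mulr_ge0//; exact: Rintegral_ge0.
Qed.

Lemma B_ge0 : 0 <= B.
Proof.
have k0 := K'_ge0; have w0 := W_gt0.
apply: mulr_ge0; first exact: mulr_ge0 (ltW w0) k0.
apply: addr_ge0 => //; apply: divr_ge0; [exact: mulr_ge0|exact: ltW].
Qed.

Lemma convn_hat_le n t : (1 <= n)%N -> t \in `[-(1/2), (1/2 : R)] ->
  hat_mod R (mu n) t <= W * expR (- (C * n%:R) * t ^+ 2) /\
  hat_mod R (kap R (kap R (mu n))) t <= B * n%:R * expR (- (C / 2 * n%:R) * t ^+ 2).
Proof.
move=> n1; rewrite in_itv /= => /andP[t1 t2].
have t4 : t ^+ 2 <= 4^-1 by rewrite expr2; nra.
pose q := expR (- C * t ^+ 2).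
have q0 : 0 <= q by exact: expR_ge0.
have q1 : q <= 1.
  by rewrite /q -[leRHS]expR0 ler_expR mulNr oppr_le0 mulr_ge0 ?sqr_ge0// ltW.
have decay m : (N0 < m)%N -> hat_mod R (nu m) t <= q.
  move=> Nm; have [t12|t12] := ltP t (1/2).
    by apply: (Hdecay m Nm); rewrite t1 t12.
  have te : t = 1/2 by lra.
  have m0 : (0 < m)%N by case: (m) Nm.
  rewrite -hat_modN; last exact: prob_l1 (Hprob m m0).
  rewrite /q -[t ^+ 2]sqrrN; apply: (Hdecay m Nm).
  by rewrite te; apply/andP; split; lra.
pose P0 m := hat_mod R (mu m) t; pose P1 m := hat_mod R (kap R (mu m)) t.
pose P2 m := hat_mod R (kap R (kap R (mu m))) t.
pose p0 m := hat_mod R (nu m) t; pose p1 m := hat_mod R (kap R (nu m)) t.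
pose p2 m := hat_mod R (kap R (kap R (nu m))) t.
have g0 m : 0 <= P0 m by exact: hat_mod_ge0.
have g1 m : 0 <= P1 m by exact: hat_mod_ge0.
have g2 m : 0 <= P2 m by exact: hat_mod_ge0.
have h0 m : 0 <= p0 m by exact: hat_mod_ge0.
have h1 m : 0 <= p1 m by exact: hat_mod_ge0.
have h2 m : 0 <= p2 m by exact: hat_mod_ge0.
have P00 : P0 0%N <= 1 by exact: hat_mod_dirac0.
have P10 : P1 0%N <= 0 by rewrite /P1 /= kap_dirac0; exact: hat_mod0.
have P20 : P2 0%N <= 0 by rewrite /P2 /= kap_dirac0 kap0; exact: hat_mod0.
have p0le1 m : p0 m.+1 <= 1.
  apply: le_trans (prob_integral_le1 _ _ (Hprob m.+1 isT)).
  by apply: cabs_hat_le; exact: prob_l1 (Hprob m.+1 isT).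
have p1le m : p1 m.+1 <= D m.+1 * `|t|.
  have [i0 i1 i2] := step_l1 m.
  exact: cabs_hat_mean0_le _ _ _ i1 i2 (step_mean0 m).
have p2le m : p2 m.+1 <= D m.+1.
  have [i0 i1 i2] := step_l1 m.
  apply: (le_trans (cabs_hat_le _ _ t i2)).
  rewrite ler_peMl ?ler1n//; exact: Rintegral_ge0.
have P0S m : P0 m.+1 <= P0 m * p0 m.+1.
  have [i0 i1 i2] := step_l1 m; have [j0 j1 j2] := convn_l1 m.
  by rewrite /P0 /p0 /= hat_mod_conv.
have P1S m : P1 m.+1 <= P1 m * p0 m.+1 + P0 m * p1 m.+1.
  have [i0 i1 i2] := step_l1 m; have [j0 j1 j2] := convn_l1 m.
  rewrite /P1 /P0 /p0 /p1 /= kap_conv// -!hat_mod_conv//.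
  by apply: hat_modD; exact: l1_conv.
have P2S m : P2 m.+1 <= P2 m * p0 m.+1 + 2 * (P1 m * p1 m.+1) + P0 m * p2 m.+1.
  have [i0 i1 i2] := step_l1 m; have [j0 j1 j2] := convn_l1 m.
  rewrite /P2 /P1 /P0 /p0 /p1 /p2 /= kap_kap_conv// -!hat_mod_conv//.
  have c1 := l1_conv _ _ _ j2 i0; have c2 := l1_conv _ _ _ j1 i1.
  have c3 := l1_conv _ _ _ j0 i2.
  apply: (le_trans (hat_modD _ _ _ t (l1D _ _ _ c1 c2) (l1D _ _ _ c2 c3))).
  have := hat_modD _ _ _ t c1 c2; have := hat_modD _ _ _ t c2 c3; lra.
have [hb0 _ hb2] := product_rule_bounds R P0 P1 P2 p0 p1 p2 (fun m => D m) q `|t| N0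
  q0 q1 (normr_ge0 t) g0 g1 g2 h0 h1 h2 P00 P10 P20 p0le1 decay p1le p2le P0S P1S P2S n.
set E := expR (- (C * n%:R) * t ^+ 2).
have qW m : (m <= N0.+2)%N -> q ^+ (n - m) <= W * E.
  move=> mN; apply: (@le_trans _ _ (q ^+ (n - N0.+2))).
    by apply: ler_wiXn2l => //; exact: leq_sub2l.
  by apply: expR_pow_le => //; exact: ltW.
have n0 : 0 <= n%:R :> R by [].
have E0 : 0 <= E by exact: expR_ge0.
have W0 := W_gt0; have k0 := K'_ge0.
split; first by apply: (le_trans hb0); apply: qW; rewrite -addn2 leq_addr.
apply: (le_trans hb2).
set Phi := \sum_(1 <= i < n.+1) D i.
have Phi0 : 0 <= Phi.
  by apply: sumr_ge0 => i _; apply: mulr_ge0 => //; exact: Rintegral_ge0.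
have PhiK : Phi <= K' * n%:R.
  by have := sum_D_le n n1; rewrite /K' -!mulrA.
have t20 : 0 <= t ^+ 2 by exact: sqr_ge0.
have Kn0 : 0 <= K' * n%:R by exact: mulr_ge0.
apply: (@le_trans _ _ ((K' * n%:R + t ^+ 2 * (K' * n%:R) ^+ 2) * (W * E))).
  rewrite mulrDl; apply: lerD.
    by apply: ler_pM => //; [exact: exprn_ge0|exact: qW].
  apply: ler_pM; [exact: sqr_ge0|exact: exprn_ge0| |exact: qW].
  rewrite exprMn real_normK ?num_real//; apply: ler_wpM2l => //.
  by rewrite ler_pXn2r.
(* Once [K' * n] is factored out, the remaining polynomial is [1 + K' * (n t^2)]. *)
have := poly_gauss_le R C K' (n%:R * t ^+ 2) C0 k0 (mulr_ge0 n0 t20).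
have -> : - C * (n%:R * t ^+ 2) = - (C * n%:R) * t ^+ 2 by ring.
have -> : - (C / 2) * (n%:R * t ^+ 2) = - (C / 2 * n%:R) * t ^+ 2 by ring.
rewrite -/E; set E2 := expR (- (C / 2 * n%:R) * t ^+ 2) => h.
have -> : (K' * n%:R + t ^+ 2 * (K' * n%:R) ^+ 2) * (W * E) =
  (W * (K' * n%:R)) * ((1 + K' * (n%:R * t ^+ 2)) * E) by ring.
have -> : B * n%:R * E2 = (W * (K' * n%:R)) * ((1 + 2 * K' / C) * E2).
  by rewrite /B; ring.
by apply: ler_wpM2l => //; apply: mulr_ge0 => //; exact: ltW.
Qed.

Let Gc := Num.sqrt (pi / (C / 2)).

(** With [s^2 = n], inversion bounds [s^2 mu_n(k)] by [W * Gc * s] and [k^2 mu_n(k)] by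
    [B * Gc * s]; their sum is the input of [hker_le], which contributes the factor 4. *)
Lemma convn_kernel_le : exists2 A : R, 0 < A & forall n k, (1 <= n)%N ->
  `|mu n k| <= A * hker R (Num.sqrt n%:R) (absz k).
Proof.
have W0 := W_gt0; have B0 := B_ge0.
have G0 : 0 < Gc by rewrite sqrtr_gt0 divr_gt0 ?pi_gt0// divr_gt0.
exists (4 * ((W + B) * Gc)); first by rewrite !mulr_gt0// ltr_pwDl.
move=> n k n1; have [i0 i1 i2] := convn_l1 n.
have nR : 1 <= n%:R :> R by rewrite ler1n.
set s := Num.sqrt n%:R.
have s1 : 1 <= s by rewrite -sqrtr1 ler_sqrt// ltr0n.
have s0 : 0 < s by lra.
have ss : s ^+ 2 = n%:R by rewrite sqr_sqrtr.
have gauss : (\int[@lebesgue_measure R]_(t in `[(-(1/2))%R, (1/2)%R])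
    (expR (- (C / 2 * n%:R) * t ^+ 2))%:E <= (Gc / s)%:E)%E.
  have a0 : 0 < C / 2 * n%:R by rewrite mulr_gt0 ?divr_gt0//; lra.
  apply: (le_trans (gauss_integral_le _ _ a0)).
  have pC : 0 <= pi / (C / 2) by rewrite divr_ge0 ?pi_ge0// divr_ge0// ltW.
  by rewrite lee_fin /Gc /s -sqrtrV// -sqrtrM// invfM mulrA.
have mE c : measurable_fun setT (fun t : R => c * expR (- (C / 2 * n%:R) * t ^+ 2)).
  by apply: measurable_funM => //; apply: measurableT_comp => //; apply: measurable_funM.
have key (u : int -> R) (c : R) : 0 <= c -> l1 R u ->
    (forall t, t \in `[-(1/2), (1/2 : R)] ->
       hat_mod R u t <= c * expR (- (C / 2 * n%:R) * t ^+ 2)) ->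
    `|u k| <= c * (Gc / s).
  move=> c0 iu hu; rewrite -lee_fin.
  apply: (le_trans (norm_le_integral_hat _ u k _ iu (mE c) hu)).
  under eq_integral do rewrite EFinM.
  rewrite ge0_integralZl ?lee_fin//.
  - by rewrite EFinM; apply: lee_wpmul2l; rewrite ?lee_fin.
  - apply: measurable_funTS; apply/measurable_EFinP.
    by have := mE 1; congr (measurable_fun _ _); apply/funext => t; rewrite mul1r.
have hA : `|mu n k| <= W * (Gc / s).
  apply: key => //; first exact: ltW.
  move=> t tD; have [h _] := convn_hat_le n t n1 tD; apply: (le_trans h).
  (* The exponent [C] is weakened to [C / 2], so that one Gaussian integral serves both
     inversions. *)
  rewrite ler_pM2l// ler_expR; have := sqr_ge0 t.
  have := mulr_gt0 C0 (lt_le_trans ltr01 nR).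
  nra.
have hB : `|kap R (kap R (mu n)) k| <= B * n%:R * (Gc / s).
  apply: key => //; first by rewrite mulr_ge0.
  by move=> t tD; have [_ h] := convn_hat_le n t n1 tD.
have muk0 := convn_ge0 n k.
move: hA hB; rewrite kap_kapE (ger0_norm muk0) ger0_norm; last first.
  by apply: mulr_ge0; [exact: sqr_ge0|apply: mulr_ge0 => //; exact: sqr_ge0].
move=> hA hB.
apply: hker_le => //; first by rewrite mulr_ge0 ?addr_ge0// ltW.
have kk : (absz k)%:R ^+ 2 = k%:~R ^+ 2 :> R.
  by rewrite -[in RHS]real_normK ?num_real// -intr_norm -abszE.
rewrite kk mulrDr (mulrDl W B Gc) (mulrDl (W * Gc)); apply: lerD.
  apply: le_trans (ler_wpM2r (sqr_ge0 s) hA) _.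
  by rewrite le_eqVlt; apply/orP; left; apply/eqP; field; rewrite gt_eqF.
(* The factor brought in by the two [kap]s is at least 1 and may be inserted. *)
apply: (@le_trans _ _ ((2 * pi) ^+ 2 * (k%:~R ^+ 2 * mu n k))).
  rewrite mulrC ler_peMl; [by []| |].
    by apply: mulr_ge0 => //; exact: sqr_ge0.
  have := pi_ge2 R; rewrite expr2; nra.
apply: (le_trans hB); rewrite -ss.
by rewrite le_eqVlt; apply/orP; left; apply/eqP; field; rewrite gt_eqF.
Qed.

(** One factor [s] of [n = s^2] is paired with [|t|] and absorbed by halving the exponent to
    [C / 4]; the other is cancelled by the Gaussian integral, of order [1 / s]. *)
Lemma convn_second_derivative_integral :
  exists M : R, forall n, (1 <= n)%N ->
    (\int[@lebesgue_measure R]_(t in `[(-(1/2))%R, (1/2)%R])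
       (hat_dd_abs (mu n) t * `|t|)%:E <= M%:E)%E.
Proof.
have B0 := B_ge0.
pose c1 : R := 1 + 2 * 1 / (C / 2).
have C20 : 0 < C / 2 by rewrite divr_gt0.
have c10 : 0 <= c1.
  by rewrite /c1; apply: addr_ge0 => //; apply: divr_ge0 => //; exact: ltW.
exists (B * c1 * Num.sqrt (pi / (C / 4))) => n n1.
have [i0 i1 i2] := convn_l1 n.
have nR : 1 <= n%:R :> R by rewrite ler1n.
pose s : R := Num.sqrt n%:R.
have s0 : 0 < s by rewrite sqrtr_gt0; lra.
have ss : s ^+ 2 = n%:R by rewrite sqr_sqrtr.
have a0 : 0 < C / 4 * n%:R by rewrite mulr_gt0 ?divr_gt0//; lra.
pose g (t : R) := B * c1 * s * expR (- (C / 4 * n%:R) * t ^+ 2).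
have mE : measurable_fun setT (fun t : R => expR (- (C / 4 * n%:R) * t ^+ 2)).
  by apply: measurableT_comp => //; apply: measurable_funM.
have mhat : measurable_fun setT (fun t => hat_dd_abs (mu n) t * `|t|).
  apply: measurable_funM; last exact: normr_measurable.
  have -> : hat_dd_abs (mu n) = hat_mod R (kap R (kap R (mu n))).
    by apply/funext => t; have [_ _ _ _ ->] := derive2_hat _ _ t i0 i1 i2.
  exact: measurable_hat_mod.
apply: (@le_trans _ _ (\int[@lebesgue_measure R]_(t in `[(-(1/2))%R, (1/2)%R]) (g t)%:E)%E).
  apply: ge0_le_integral => //.
  - by move=> t _; rewrite lee_fin mulr_ge0// sqrtr_ge0.
  - by apply: measurable_funTS; exact/measurable_EFinP.
  - by apply: measurable_funTS; apply/measurable_EFinP; apply: measurable_funM.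
  move=> t tD; rewrite lee_fin; have [_ _ _ _ ->] := derive2_hat _ _ t i0 i1 i2.
  have [_ h] := convn_hat_le n t n1 tD.
  apply: (le_trans (ler_wpM2r (normr_ge0 t) h)).
  have t20 : 0 <= t ^+ 2 by exact: sqr_ge0.
  have n0 : 0 <= n%:R :> R by [].
  have := poly_gauss_le R (C / 2) 1 (n%:R * t ^+ 2) C20 ler01 (mulr_ge0 n0 t20).
  rewrite -/c1.
  have -> : - (C / 2) * (n%:R * t ^+ 2) = - (C / 2 * n%:R) * t ^+ 2 by ring.
  have -> : - (C / 2 / 2) * (n%:R * t ^+ 2) = - (C / 4 * n%:R) * t ^+ 2 by field.
  rewrite /g; set E2 := expR _; set E4 := expR _ => hh.
  have E20 : 0 <= E2 by exact: expR_ge0.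
  (* This is [z <= 1 + z^2] for [z = s |t|], which fits [poly_gauss_le] with [c = 1]; hence the
     constant [c1]. *)
  have st : s * `|t| <= 1 + 1 * (n%:R * t ^+ 2).
    rewrite -ss -(real_normK (num_real t)); have := sqr_ge0 (s * `|t| - 1).
    have := sqr_ge0 (s * `|t|); rewrite sqrrB exprMn; lra.
  have -> : B * n%:R * E2 * `|t| = B * s * (s * `|t| * E2) by rewrite -ss; ring.
  have -> : B * c1 * s * E4 = B * s * (c1 * E4) by ring.
  apply: ler_wpM2l; first by rewrite mulr_ge0// ltW.
  by apply: le_trans hh; exact: ler_wpM2r.
rewrite /g; under eq_integral do rewrite EFinM.
have k0 : 0 <= B * c1 * s by apply: mulr_ge0; [exact: mulr_ge0|exact: ltW].
rewrite ge0_integralZl ?lee_fin//; last first.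
  by apply: measurable_funTS; exact/measurable_EFinP.
apply: (@le_trans _ _ ((B * c1 * s)%:E * (Num.sqrt (pi / (C / 4 * n%:R)))%:E)%E).
  by apply: lee_wpmul2l; [rewrite lee_fin|exact: gauss_integral_le].
have -> : Num.sqrt (pi / (C / 4)) = s * Num.sqrt (pi / (C / 4 * n%:R)).
  rewrite /s -sqrtrM//; congr Num.sqrt.
  by field; apply/andP; split; rewrite gt_eqF//; lra.
by rewrite -EFinM lee_fin mulrA.
Qed.

End GaussianDecay.

Theorem theorem2p1p3 (R : realType) (nu : nat -> int -> R)
  (Hprob : forall n, (1 <= n)%N -> is_prob (nu n))
  (Hap : forall n, (1 <= n)%N -> strictly_aperiodic (nu n))
  (Hmean : forall n, (1 <= n)%N ->
     sym_psum (fun k => k%:~R * nu n k) @ \oo --> (0 : R))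
  (Hphi : exists K : R, forall n, (1 <= n)%N ->
     (\sum_(1 <= i < n.+1) m2 (nu i) <= (K * n%:R)%:E)%E)
  (Hdecay : exists C : R, 0 < C /\ exists N0 : nat, (0 < N0)%N /\
     forall n, (N0 < n)%N -> forall t : R, -(1/2) <= t < 1/2 ->
       hat_abs (nu n) t <= expR (- C * t ^+ 2)) :
  ((forall n, (1 <= n)%N -> forall t : R,
      derivable (hat_re (convn nu n)) t 1 /\
      derivable (derive1 (hat_re (convn nu n))) t 1 /\
      derivable (hat_im (convn nu n)) t 1 /\
      derivable (derive1 (hat_im (convn nu n))) t 1) /\
   exists B : R, forall n, (1 <= n)%N ->
     (\int[lebesgue_measure]_(t in `[(-(1/2))%R, (1/2)%R])
        (hat_dd_abs (convn nu n) t * `|t|)%:E <= B%:E)%E)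
  /\
  (forall (d : measure_display) (X : measurableType d) (m : probability X R)
          (tau tau' : X -> X),
     nonatomic m -> separable_space m -> inv_mp m tau tau' ->
     exists C' : R, forall (f : X -> R), m.-integrable setT (EFin \o f) ->
       forall lam : R, 0 < lam ->
         (m [set x | lam%:E < max_op tau tau' nu f x]
            <= (C' / lam)%:E * \int[m]_x (`|f x|)%:E)%E).
Proof.
move: Hphi => [K HK]; move: Hdecay => [C [C0 [N0 [_ Hdec]]]].
have cl1 := convn_l1 R nu K Hprob HK.
split; first split.
- move=> n n1 t; have [i0 i1 i2] := cl1 n.
  by have [? ? ? ? _] := derive2_hat R _ t i0 i1 i2.
- exact: (convn_second_derivative_integral R nu K C N0 Hprob Hmean HK C0 Hdec).
move=> d X m tau tau' _ _ tauP.
have [A A0 muA] := convn_kernel_le R nu K C N0 Hprob Hmean HK C0 Hdec.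
(* [A] comes from the measures [nu n] alone, so the constant is the same for all systems. *)
exists (4 * A) => f fint lam lam0.
apply: (weak_type_of_kernel d X R m tau tau' (Defs.convn nu)
  (fun n => Num.sqrt n%:R) A) => //.
by move=> n n1; rewrite sqrtr_gt0 ltr0n.
Qed.
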